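(* Let $\kappa$ be an infinite cardinal and let $G$ be a graph of type $H_{\kappa,\kappa}$ with main class $A$, with an edge-colouring $c\colon E(G)\to[r]$. Then there exist a colour $k\in[r]$ and a set $X\subseteq A$ with $|X|=\kappa$ such that $X$ is $\kappa$-star-linked in colour $k$ and $X$ is covered by a generalised path of cardinality $\kappa$, monochromatic in colour $k$, which is concentrated on $X$ (in the subgraph of colour-$k$ edges).
   Context: A graph $G=(V,E)$ is of type $H_{\kappa,\kappa}$ if there are (not necessarily disjoint) sets $A,B$ with $V=A\cup B$ and enumerations $A=\{a_\xi:\xi<\kappa\}$, $B=\{b_\xi:\xi<\kappa\}$ such that $a_\xi b_\zeta\in E$ whenever $\xi\le\zeta<\kappa$ (with $a_\xi\neq b_\zeta$); $A$ is the main class. A generalised path is a graph $P$ with a well-order $\prec$ on $V(P)$ such that for every vertex $v$ and every $v'\prec v$ there is a neighbour $w$ of $v$ in $P$ with $v'\preceq w\prec v$; $\Lambda(P)$ is the set of limit elements. A path $P$ in a graph $H$ is concentrated on $S$ if $N_H(v)\cap S\cap\{u: x\preceq u\prec v\}\ne\emptyset$ for all $v\in\Lambda(P)$ and all $x\prec v$. $X$ is $\kappa$-star-linked in colour $k$ if for every finite $F\subseteq X$ the common neighbourhood of $F$ in the subgraph of colour-$k$ edges has cardinality $\kappa$. *)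

(* Defs.v *)
From mathcomp Require Import all_boot.
From mathcomp Require Import wochoice.
From mathcomp Require Import all_classical.

Set Implicit Arguments.
Unset Strict Implicit.
Unset Printing Implicit Defensive.

Local Open Scope classical_set_scope.
Local Open Scope card_scope.

Definition strict (T : Type) (le : rel T) (x y : T) : Prop := le x y /\ x <> y.

(* A cardinal is an initial ordinal: the well-ordered type [K] stands for the
   set of all ordinals below kappa, and no proper initial segment is
   equinumerous with [K].  [well_order] implies that [le] is a total order. *)
Definition is_cardinal (K : Type) (le : rel K) : Prop :=
  well_order le /\
  forall xi : K, ~ ([set: K] #<= [set zeta : K | strict le zeta xi]).

Definition is_infinite_cardinal (K : Type) (le : rel K) : Prop :=
  is_cardinal le /\ infinite_set [set: K].

Record graph (U : Type) := Graph {
  verts : set U;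
  edges : set (set U);
  edgesP : forall e, edges e ->
    exists x y, [/\ verts x, verts y, x <> y & e = [set x; y]]
}.

Definition adj (U : Type) (G : graph U) (x y : U) : Prop :=
  edges G [set x; y].

Definition nbhd (U : Type) (G : graph U) (x : U) : set U :=
  [set y | adj G x y].

(* Intersecting with [verts G] matters only for F = set0, where the common
   neighbourhood is the whole vertex set. *)
Definition common_nbhd (U : Type) (G : graph U) (F : set U) : set U :=
  verts G `&` \bigcap_(x in F) nbhd G x.

Definition subgraph (U : Type) (P G : graph U) : Prop :=
  verts P `<=` verts G /\ edges P `<=` edges G.

Section ColourGraph.
Variables (U : Type) (G : graph U) (r : nat) (c : edges G -> 'I_r) (k : 'I_r).

Definition colour_edges : set (set U) := set_val @` (c @^-1` [set k]).

Lemma colour_edgesP e : colour_edges e ->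
  exists x y, [/\ verts G x, verts G y, x <> y & e = [set x; y]].
Proof. by case=> f _ <-; apply: edgesP; apply: set_valP. Qed.

Definition colour_graph : graph U := Graph colour_edgesP.

End ColourGraph.

(* G is of type H_{kappa,kappa} with main class A.  The enumerations are
   injective, so that both classes have cardinality kappa. *)
Definition type_H (K : Type) (le : rel K) (U : Type) (G : graph U)
    (A : set U) : Prop :=
  exists (B : set U) (a b : K -> U),
    [/\ verts G = A `|` B,
        set_bij [set: K] A a,
        set_bij [set: K] B b
      & forall xi zeta : K, le xi zeta -> a xi <> b zeta ->
          adj G (a xi) (b zeta)].

(* [wo_chain le (mem V)]: [le] restricted to V is a well-order (in particular
   total, antisymmetric and transitive on V). *)
Definition generalised_path (U : Type) (P : graph U) (le : rel U) : Prop :=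
  wo_chain le (mem (verts P)) /\
  forall v v', verts P v -> verts P v' -> strict le v' v ->
    exists w, [/\ verts P w, adj P v w, le v' w & strict le w v].

Definition limit_elements (U : Type) (P : graph U) (le : rel U) : set U :=
  [set v | [/\ verts P v,
               exists2 u, verts P u & strict le u v
             & forall u, verts P u -> strict le u v ->
                 exists w, [/\ verts P w, strict le u w & strict le w v]]].

Definition concentrated (U : Type) (H P : graph U) (le : rel U)
    (S : set U) : Prop :=
  forall v x, limit_elements P le v -> verts P x -> strict le x v ->
    nbhd H v `&` S `&` [set u | [/\ verts P u, le x u & strict le u v]] !=set0.

Definition star_linked (K : Type) (U : Type) (H : graph U) (X : set U) : Prop :=
  forall F : set U, F `<=` X -> finite_set F -> common_nbhd H F #= [set: K].

(* Main.v *)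
(* Fix a maximal set D of colours in all of which some X of size kappa inside A
   is kappa-star-linked.  By maximality (an ultrafilter would otherwise produce a
   further colour) every large part of X contains a finite block F to which
   almost every vertex of the other class sends an edge with colour in D; so
   kappa many disjoint blocks and the other class again form a half graph, now
   coloured with D.  Consecutive vertices of a path can always be connected by
   star-linkedness, whence only limit vertices matter: a path is reduced to a
   "spine", a well-order of blocks with suitable vertices at its limits.

   Spines are found by induction on kappa.  Choose a half graph with as few
   colours as possible; then no colour k can be avoided on a large set, i.e. for
   every d there is h(d) > d such that almost all vertices above h(d) have a
   k-neighbour in [d, h(d)).  Iterating h yields a closed chain of points t at
   which almost every vertex has k-neighbours cofinally below t.  Each interval
   [t, h(t)) is absorbed into a smaller spine with a last element, given by the
   induction hypothesis in a colour k that works for all intervals, and these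
   spines are concatenated. *)
Require Import Defs.
From mathcomp Require Import all_boot.
From mathcomp Require Import wochoice.
From mathcomp Require Import all_classical.

Set Implicit Arguments.
Unset Strict Implicit.
Unset Printing Implicit Defensive.

Local Open Scope classical_set_scope.
Local Open Scope card_scope.

(** * Well-orders and cardinals *)

(** The induction hypothesis is about complete bipartite graphs although half graphs are treated:
    the part of a half graph below a point is completely joined to a large set of the other class.
    That set is strictly larger than the part, so all exceptional vertices can be avoided and some
    vertex sees every tail of the small spine; it serves as the limit vertex of an added last
    element. Last elements are what makes concatenation work. Without them the start of the next
    piece would be a limit of the preceding piece alone, and nothing provides neighbours there. With
    them, the start of a piece is a limit only if earlier pieces accumulate at it, where whole
    intervals supply the neighbours. The main class is split in two: one half hosts the pieces, the
    other consists of the interval vertices in which limit vertices find their neighbours. The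
    latter are attached to positions of the piece, which is why a position stands for a block. Since
    the cardinal may be singular, a union of few small sets need not be small. Several choices below
    (size bounds on pieces, the size of [h d], blocks of least exceptional set) serve only to
    provide a common bound. *)

Section Cardinals.

Lemma card_leI (T U : Type) (A : set T) (B : set U) (f : T -> U) :
  (forall x, A x -> B (f x)) ->
  (forall x y, A x -> A y -> f x = f y -> x = y) -> A #<= B.
Proof.
move=> fAB finj.
have [g] : $|{injfun A >-> B}|.
  apply/injfunPex; exists f; first by move=> x /fAB.
  by move=> x y /set_mem Ax /set_mem Ay; apply: finj.
exact: inj_card_le g.
Qed.

Lemma card_leE (T U : Type) (u0 : U) (A : set T) (B : set U) : A #<= B ->
  exists f : T -> U, (forall x, A x -> B (f x)) /\
    (forall x y, A x -> A y -> f x = f y -> x = y).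
Proof.
move=> /card_leP[f].
exists (fun x => if pselect (A x) is left h then val (f (SigSub (mem_set h))) else u0).
split=> [x Ax|x y Ax Ay].
  by case: pselect => // h; apply: set_valP.
case: pselect => // hx; case: pselect => // hy /val_inj /inj e.
by have [] := e (mem_set I) (mem_set I).
Qed.

(** Relativised to [Y], with [lt] arbitrary elsewhere: one type carries many well-orders of
    different subsets. *)
Definition wo (T : Type) (lt : T -> T -> Prop) (Y : set T) : Prop :=
  [/\ forall x, Y x -> ~ lt x x,
      forall x y z, Y x -> Y y -> Y z -> lt x y -> lt y z -> lt x z
    & forall S, S `<=` Y -> S !=set0 ->
        exists m, S m /\ forall s, S s -> s = m \/ lt m s].

Definition seg (T : Type) (lt : T -> T -> Prop) (Y : set T) (x : T) : set T :=
  [set y | Y y /\ lt y x].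

Lemma wo_sub T lt (Y Z : set T) : wo lt Y -> Z `<=` Y -> wo lt Z.
Proof.
case=> ir tr mn ZY; split.
- by move=> x /ZY/ir.
- by move=> x y z /ZY Yx /ZY Yy /ZY Yz; apply: tr.
- by move=> S SZ; apply: mn => x /SZ/ZY.
Qed.

Lemma wo_total T lt (Y : set T) x y : wo lt Y -> Y x -> Y y ->
  [\/ x = y, lt x y | lt y x].
Proof.
case=> _ _ mn Yx Yy.
have [||m [] /= ] := mn [set z | z = x \/ z = y].
- by move=> z /= [] ->.
- by exists x; left.
case=> -> h.
  by have [|->|] := h y; [right|apply: Or31|apply: Or32].
by have [|->|] := h x; [left|apply: Or31|apply: Or33].
Qed.

Lemma wo_asym T lt (Y : set T) x y : wo lt Y -> Y x -> Y y ->
  lt x y -> ~ lt y x.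
Proof.
by case=> ir tr _ Yx Yy xy yx; apply: (ir x Yx); apply: (tr _ y).
Qed.

Lemma wo_le_lt T lt (Y : set T) x y z : wo lt Y -> Y x -> Y y -> Y z ->
  x = y \/ lt x y -> lt y z -> lt x z.
Proof.
by case=> ir tr _ Yx Yy Yz [-> //|]; apply: tr.
Qed.

Lemma wo_lt_le T lt (Y : set T) x y z : wo lt Y -> Y x -> Y y -> Y z ->
  lt x y -> y = z \/ lt y z -> lt x z.
Proof.
by case=> ir tr _ Yx Yy Yz xy [<- //|]; apply: tr.
Qed.

Lemma wo_nlt T lt (Y : set T) x y : wo lt Y -> Y x -> Y y ->
  ~ lt x y -> y = x \/ lt y x.
Proof. by move=> w Yx Yy nxy; have [->|/nxy|] := wo_total w Yx Yy; auto. Qed.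

Lemma wo_min T lt (Y S : set T) : wo lt Y -> S `<=` Y -> S !=set0 ->
  exists m, S m /\ forall s, S s -> ~ lt s m.
Proof.
move=> w SY S0; have [ir tr mn] := w; have [m [Sm h]] := mn _ SY S0.
exists m; split=> // s Ss sm; have [e|ms] := h _ Ss.
  by apply: (ir m (SY _ Sm)); rewrite -{1}e.
by apply: (wo_asym w _ _ sm ms); apply: SY.
Qed.

Lemma wo_ind T lt (Y : set T) (P : T -> Prop) : wo lt Y ->
  (forall x, Y x -> (forall y, Y y -> lt y x -> P y) -> P x) ->
  forall x, Y x -> P x.
Proof.
move=> w step x Yx; apply: contrapT => nPx.
have [||m [[Ym nPm] h]] := @wo_min _ _ _ (Y `&` [set z | ~ P z]) w.
- by move=> z [].
- by exists x.
apply: nPm; apply: step => // y Yy ym; apply: contrapT => nPy.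
exact: (h y).
Qed.

Lemma wo_pull T U lt (Y : set U) (X : set T) (f : T -> U) : wo lt Y ->
  (forall x, X x -> Y (f x)) ->
  (forall x y, X x -> X y -> f x = f y -> x = y) ->
  wo (fun a b => lt (f a) (f b)) X.
Proof.
move=> [ir tr mn] fXY finj; split.
- by move=> x /fXY/ir.
- by move=> x y z /fXY Yx /fXY Yy /fXY Yz; apply: tr.
- move=> S SX [x Sx]; have [||m [[z Sz <-] h]] := mn (f @` S).
  + by move=> _ [z /SX/fXY Yz <-].
  + by exists (f x); exists x.
  + exists z; split=> // s Ss; have [|e|l] := h (f s); first by exists s.
      by left; apply: finj => //; apply: SX.
    by right.
Qed.

Lemma seg_sub T lt (Y : set T) x : seg lt Y x `<=` Y.
Proof. by move=> y []. Qed.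

Lemma seg_subset T lt (Y : set T) x y : wo lt Y -> Y x -> Y y ->
  x = y \/ lt x y -> seg lt Y x `<=` seg lt Y y.
Proof.
by move=> w Yx Yy xy z [Yz zx]; split=> //; apply: (wo_lt_le w _ _ _ zx xy).
Qed.

Lemma wo_acc T lt (Y : set T) : wo lt Y ->
  well_founded (fun a b => [/\ Y a, Y b & lt a b]).
Proof.
move=> w x; have [Yx|nYx] := pselect (Y x); last first.
  by constructor=> y [].
move: Yx; apply: (wo_ind w) => {}x Yx IH; constructor=> y [Yy _ yx].
exact: IH.
Qed.

(** Well-founded recursion in which a step sees only the set [S] of earlier values. The bound of [S]
    by the segment is what counting arguments use. All transfinite recursions below pass through
    this lemma. *)
Lemma greedy T D (d0 : D) lt (Y : set T) (P : T -> set D -> D -> Prop) :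
  wo lt Y ->
  (forall t S, Y t -> S #<= seg lt Y t -> exists d, P t S d) ->
  exists f : T -> D, forall t, Y t -> P t (f @` seg lt Y t) (f t).
Proof.
move=> w step.
pose R a b := [/\ Y a, Y b & lt a b].
pose S t (rec : forall s, R s t -> D) : set D :=
  [set d | exists s (h : R s t), d = rec s h].
pose F t (rec : forall s, R s t -> D) : D :=
  if pselect (exists d, P t (S t rec) d) is left e then projT1 (cid e) else d0.
pose f := Fix (wo_acc w) (fun=> D) F.
have fE t : f t = F t (fun s _ => f s).
  rewrite /f Fix_eq // => x g g' gg'; congr F.
  by apply: functional_extensionality_dep => y;
     apply: functional_extensionality_dep => h; apply: gg'.
exists f => t Yt; rewrite fE /F.
have SE : S t (fun s _ => f s) = f @` seg lt Y t.
  apply/seteqP; split=> [d [s [[Ys _ st] ->]]|_ [s [Ys st] <-]].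
    by exists s.
  by exists s; exists (And3 Ys Yt st).
rewrite SE; case: pselect => [e|[]]; first by case: cid.
by apply: step => //; apply: card_image_le.
Qed.

(** At stage [t] the used values are at most as many as the points before [t], so they cannot
    exhaust [B t]. *)
Lemma greedy_inj T D (d0 : D) lt (Y : set T) (B : T -> set D) :
  wo lt Y -> (forall t, Y t -> ~ (B t #<= seg lt Y t)) ->
  exists f : T -> D, (forall t, Y t -> B t (f t)) /\
    (forall s t, Y s -> Y t -> f s = f t -> s = t).
Proof.
move=> w hB.
have [|f fP] := @greedy T D d0 lt Y (fun t S d => B t d /\ ~ S d) w.
  move=> t S Yt St; apply: contrapT => h; apply: (hB t Yt).
  apply: card_le_trans St; apply: subset_card_le => d Bd.
  by apply: contrapT => nS; apply: h; exists d.
exists f; split=> [t /fP[] //|s t Ys Yt est].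
have [//|st|ts] := wo_total w Ys Yt.
- by have [_ []] := fP t Yt; exists s.
- by have [_ []] := fP s Ys; exists t.
Qed.

Lemma well_order_refl (T : Type) (R : rel T) x : well_order R -> R x x.
Proof.
move=> woR; have [|t [[/asboolP -> h] _]] := woR [pred t | `[< t = x >]].
  by exists x; apply/asboolP.
by apply: h; apply/asboolP.
Qed.

(** [well_order] only provides unique minima. Antisymmetry comes from uniqueness on a pair,
    transitivity from the minimum of a triple. *)
Lemma wo_strict (T : Type) (R : rel T) : well_order R -> wo (strict R) setT.
Proof.
move=> woR.
have mn (S : set T) : S !=set0 -> exists m, S m /\ forall s, S s -> R m s.
  move=> [x Sx]; have [|m [[/asboolP Sm h] _]] := woR [pred z | `[< S z >]].
    by exists x; apply/asboolP.
  by exists m; split=> // s Ss; apply: h; apply/asboolP.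
have anti (x y : T) : R x y -> R y x -> x = y.
  move=> xy yx; have [|z [_ u]] := woR [pred z | `[< z = x \/ z = y >]].
    by exists x; apply/asboolP; left.
  rewrite -(u x) ?(u y) //; split; try by apply/asboolP; auto.
    by move=> t /asboolP[] -> //; apply: well_order_refl.
  by move=> t /asboolP[] -> //; apply: well_order_refl.
split.
- by move=> x _ [].
- move=> x y z _ _ _ [xy nxy] [yz nyz].
  have [m [h1 h2]] :=
    mn [set t | [\/ t = x, t = y | t = z]] (ex_intro _ x (Or31 _ _ erefl)).
  have Rxz : R x z.
    case: h1 => e.
    - by rewrite -{1}e; apply: h2; apply: Or33.
    - by case: nxy; apply: anti => //; rewrite -{1}e; apply: h2; apply: Or31.
    - by case: nyz; apply: anti => //; rewrite -{1}e; apply: h2; apply: Or32.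
  by split=> // e; apply: nxy; apply: anti => //; rewrite e.
- move=> S _ /mn[m [Sm h]]; exists m; split=> // s Ss.
  have [->|ne] := pselect (s = m); [by left|right].
  by split; [exact: h|move=> e; apply: ne].
Qed.

Lemma wo_exists (T : Type) : exists lt : T -> T -> Prop, wo lt setT.
Proof.
have [R woR] := well_ordering_principle {classic T}.
by exists (strict (R : rel T)); apply: wo_strict.
Qed.

(** If [B] does not embed into [A], it embeds into no segment of a well-order of [A], so the greedy
    choice never runs out of elements of [B]. *)
Lemma card_le_total T U (A : set T) (B : set U) : A #<= B \/ B #<= A.
Proof.
have [BA|nBA] := pselect (B #<= A); [by right|left].
have [u0] : B !=set0.
  by apply/set0P; apply/eqP => B0; apply: nBA; rewrite B0; exact: card_ge0.
move=> Bu0.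
have [lt w] := wo_exists T.
have [||f [fB finj]] := @greedy_inj T U u0 lt A (fun=> B).
- exact: wo_sub w _.
- move=> t At h; apply: nBA; apply: card_le_trans h _.
  by apply: subset_card_le => x [].
- exact: (card_leI fB finj).
Qed.

Lemma card_leNge T U (A : set T) (B : set U) : ~ (A #<= B) -> B #<= A.
Proof. by have [|] := card_le_total A B. Qed.

(** The order type of [Y] is the initial ordinal of its cardinality. *)
Definition cwo (T : Type) (lt : T -> T -> Prop) (Y : set T) : Prop :=
  wo lt Y /\ forall x, Y x -> ~ (Y #<= seg lt Y x).

(** If some segment receives an injection of [Y], take the least point [m] with such a segment and
    pull the order back along the injection. *)
Lemma cwo_exists T (Y : set T) : exists lt, cwo lt Y.
Proof.
have [lt w0] := wo_exists T.
have w : wo lt Y by apply: wo_sub w0 _.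
have [h|] := pselect (forall x, Y x -> ~ (Y #<= seg lt Y x)).
  by exists lt.
move/existsNP => [x0 /not_implyP[Yx0 /contrapT h0]].
have [||m [[Ym hm] mmin]] := @wo_min _ _ _ [set x | Y x /\ Y #<= seg lt Y x] w.
- by move=> x [].
- by exists x0.
have [f [fm finj]] := card_leE m hm.
exists (fun a b => lt (f a) (f b)); split.
  by apply: (wo_pull w) => // x /fm[].
move=> x Yx hx; apply: (mmin (f x)); last by have [] := fm x Yx.
split; first by have [] := fm x Yx.
apply: card_le_trans hx _; apply: (@card_leI _ _ _ _ f).
  by move=> y [Yy lyx]; split=> //; have [] := fm y Yy.
by move=> y z [Yy _] [Yz _]; apply: finj.
Qed.

(** Otherwise the greedy choice would inject [Y] into [A]. This is how being smaller than [Y]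
    becomes being bounded by a single proper segment. *)
Lemma card_le_seg T U lt (Y : set T) (A : set U) : wo lt Y ->
  ~ (Y #<= A) -> exists2 x, Y x & A #<= seg lt Y x.
Proof.
move=> w nYA; apply: contrapT => h; apply: nYA.
have [[u0]|nU] := pselect (inhabited U).
  have [|f [fA finj]] := @greedy_inj T U u0 lt Y (fun=> A) w.
    by move=> t Yt hA; apply: h; exists t.
  exact: (card_leI fA finj).
have A0 : A = set0 by apply/seteqP; split=> x //; case: nU.
suff -> : Y = set0 by apply: card_ge0.
apply/seteqP; split=> // x Yx; apply: h; exists x => //.
by rewrite A0; apply: card_ge0.
Qed.

Lemma card_le_setU1 T (A : set T) x : infinite_set A -> A `|` [set x] #<= A.
Proof.
have [Ax|nAx] := pselect (A x).
  by move=> _; apply: subset_card_le => y [//|->].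
move=> /infiniteP h; have [f [fA finj]] := card_leE x h.
(* Hilbert's hotel along [f]: [x] takes the place [f 0] and each [f n] moves to [f n.+1]. *)
pose g y := if pselect (y = x) is left _ then f 0%N else
  if pselect (exists n, y = f n) is left e then f (projT1 (cid e)).+1 else y.
apply: (@card_leI _ _ _ _ g).
  move=> y Ay; rewrite /g; case: pselect => [_|nyx]; first exact: fA.
  case: pselect => [e|_]; first exact: fA.
  by case: Ay => [//|/nyx].
have finj' m n : f m = f n -> m = n by apply: finj.
move=> y z _ _; rewrite /g.
case: (pselect (y = x)) => [->|nyx]; case: (pselect (z = x)) => [->|nzx] //.
- by case: pselect => [e /finj' //|n e]; case: n; exists 0%N.
- by case: pselect => [e /finj' //|n e]; case: n; exists 0%N.
case: (pselect (exists n, y = f n)) => [e|ne];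
  case: (pselect (exists n, z = f n)) => [e'|ne'] //.
- by case: cid => m /= ->; case: cid => n /= -> /finj' [->].
- by move=> h'; case: ne'; exists (projT1 (cid e)).+1.
- by move=> h'; case: ne; exists (projT1 (cid e')).+1.
Qed.

Lemma card_leX T1 T2 U1 U2 (A1 : set T1) (A2 : set T2) (B1 : set U1)
    (B2 : set U2) : A1 #<= B1 -> A2 #<= B2 -> A1 `*` A2 #<= B1 `*` B2.
Proof.
move=> h1 h2.
have [[[u1] [u2]]|nU] := pselect (inhabited U1 /\ inhabited U2); last first.
  suff -> : A1 `*` A2 = set0 by apply: card_ge0.
  apply/seteqP; split=> // -[x y] [/= A1x A2y]; apply: nU; split.
    have: B1 !=set0.
      apply/set0P/eqP => e; move: h1; rewrite e => /card_le0P A0.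
      by rewrite A0 in A1x.
    by case.
  have: B2 !=set0.
    apply/set0P/eqP => e; move: h2; rewrite e => /card_le0P A0.
    by rewrite A0 in A2y.
  by case.
have [f [fA finj]] := card_leE u1 h1; have [g [gA ginj]] := card_leE u2 h2.
apply: (@card_leI _ _ _ _ (fun p => (f p.1, g p.2))).
  by move=> [x y] [/= /fA ? /gA ?].
move=> [x y] [x' y'] [/= Ax Ay] [/= Ax' Ay'] [fe ge].
by rewrite (finj _ _ Ax Ax' fe) (ginj _ _ Ay Ay' ge).
Qed.

(** The canonical order [L] of pairs compares maxima first and then lexicographically. Pairs before
    one with maximum [m] lie in the square of the closed segment of [m], which is smaller than [Y];
    hence a greedy injection into [Y] exists. *)
Lemma card_sq_step T lt (Y : set T) : infinite_set Y -> cwo lt Y ->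
  (forall x, Y x -> infinite_set (seg lt Y x) ->
    seg lt Y x `*` seg lt Y x #<= seg lt Y x) ->
  Y `*` Y #<= Y.
Proof.
move=> Yinf [w sm] IH; have [ir tr mn] := w.
have [y0 Yy0] : Y !=set0 by apply: infinite_setN0.
pose mx (p : T * T) := if pselect (lt p.1 p.2) then p.2 else p.1.
have mxY p : (Y `*` Y) p -> Y (mx p) by case: p => a b [/= Ya Yb]; rewrite /mx; case: pselect.
have mx1 p : (Y `*` Y) p -> p.1 = mx p \/ lt p.1 (mx p).
  by case: p => a b [/= Ya Yb]; rewrite /mx /=; case: pselect; auto.
have mx2 p : (Y `*` Y) p -> p.2 = mx p \/ lt p.2 (mx p).
  case: p => a b [/= Ya Yb]; rewrite /mx /=; case: pselect => /= h; auto.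
  exact: (wo_nlt w Ya Yb h).
pose L p q := lt (mx p) (mx q) \/
  (mx p = mx q /\ (lt p.1 q.1 \/ (p.1 = q.1 /\ lt p.2 q.2))).
have wL : wo L (Y `*` Y).
  split.
  - move=> p Yp; case=> [|[_ [|[_]]]]; apply: ir; [exact: mxY|by case: Yp|by case: Yp].
  - move=> p q s Yp Yq Ys.
    have [[p1 p2] [q1 q2] [s1 s2]] := And3 Yp Yq Ys.
    case=> [pq|[epq pq]] [qs|[eqs qs]].
    + by left; apply: tr qs => //; apply: mxY.
    + by left; rewrite -eqs.
    + by left; rewrite epq.
    + right; split; first by rewrite epq.
      case: pq => [pq|[e1 pq]]; case: qs => [qs|[e2 qs]].
      * by left; apply: tr qs.
      * by left; rewrite -e2.
      * by left; rewrite e1.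
      * by right; split; [rewrite e1|apply: tr qs].
  - move=> S SY S0.
    have [||m [[p0 Sp0 <-] hm]] := mn (mx @` S).
    + by move=> _ [p Sp <-]; apply: mxY; apply: SY.
    + by have [p Sp] := S0; exists (mx p); exists p.
    have [||m1 [[p1 [Sp1 e1] <-] hm1]] := mn (fst @` (S `&` [set p | mx p = mx p0])).
    + by move=> _ [p [Sp _] <-]; case: (SY _ Sp).
    + by exists p0.1; exists p0.
    have [||m2 [[p2 [Sp2 e2 e2'] <-] hm2]] :=
       mn (snd @` [set p | [/\ S p, mx p = mx p0 & p.1 = p1.1]]).
    + by move=> _ [p [Sp _ _] <-]; case: (SY _ Sp).
    + by exists p1.2; exists p1.
    exists p2; split=> // s Ss.
    have [||l] := hm (mx s); first by exists s.
    2: by right; left; rewrite e2.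
    move=> es; have [||l] := hm1 s.1; first by exists s.
    2: by right; right; rewrite e2 es e2'; split=> //; left.
    move=> es1; have [||l] := hm2 s.2; first by exists s.
    2: by right; right; rewrite e2 es e2' es1; split=> //; right.
    move=> es2; left; case: s p2 {Sp2 hm2 e2} Ss es es1 es2 e2' => [a b] [c d] /=.
    by move=> _ _ -> -> ->.
have [|f [fY finj]] := @greedy_inj _ T y0 L (Y `*` Y) (fun=> Y) wL.
  move=> p Yp hle; have Ym := mxY _ Yp.
  set m := mx p in Ym.
  have sub : seg L (Y `*` Y) p `<=` (seg lt Y m `|` [set m]) `*` (seg lt Y m `|` [set m]).
    move=> q [Yq Lqp].
    have qm : mx q = m \/ lt (mx q) m by case: Lqp; [right|case; left].
    have Yqm := mxY _ Yq.
    split.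
      have [e|l] := mx1 _ Yq.
        by case: qm => [<-|h]; [right|left; split; [case: Yq|rewrite e]].
      left; split; first by case: Yq.
      by apply: (wo_lt_le w _ _ _ l qm) => //; case: Yq.
    have [e|l] := mx2 _ Yq.
      by case: qm => [<-|h]; [right|left; split; [case: Yq|rewrite e]].
    left; split; first by case: Yq.
    by apply: (wo_lt_le w _ _ _ l qm) => //; case: Yq.
  have {sub} hle2 := card_le_trans hle (subset_card_le sub).
  have [fin|inf] := pselect (finite_set (seg lt Y m)).
    apply: Yinf; apply: (card_le_finite hle2); apply: finite_setX;
    by rewrite finite_setU.
  apply: (sm m Ym); apply: card_le_trans hle2 _.
  apply: card_le_trans (IH m Ym inf).
  by apply: card_leX; apply: card_le_setU1.
exact: (card_leI fY finj).
Qed.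

Lemma card_sq T (Y : set T) : infinite_set Y -> Y `*` Y #<= Y.
Proof.
move=> Yinf; have [lt cw] := cwo_exists Y; have [w sm] := cw.
apply: (card_sq_step Yinf cw); apply: (wo_ind w) => x Yx IH inf.
(* [m] is the least point whose segment is as large as that of [x]. Before [x], the induction
   hypothesis at [m] applies; if it is [x], the segment of [x] has initial order type. *)
have [||m [[Ym hm] mmin]] :=
  @wo_min _ _ _ [set y | Y y /\ seg lt Y x #<= seg lt Y y] w.
- by move=> y [].
- by exists x.
have ninf : infinite_set (seg lt Y m) by move=> /(card_le_finite hm).
have xm : m = x \/ lt m x by apply: (wo_nlt w) => //; apply: mmin; split.
have mx := seg_subset w Ym Yx xm.
case: xm => [e|lmx]; last first.
  apply: card_le_trans (card_leX hm hm) _.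
  by apply: card_le_trans (IH m Ym lmx ninf) _; apply: subset_card_le.
subst m.
have sseg y : seg lt Y x y -> seg lt (seg lt Y x) y = seg lt Y y.
  move=> [Yy yx]; apply/seteqP; split=> z [] => [[Yz _] zy|Yz zy]; split=> //.
  by split=> //; apply: (wo_lt_le w _ _ _ zy); auto.
apply: (@card_sq_step _ lt) => //.
  split; first by apply: wo_sub w (@seg_sub _ _ _ _).
  by move=> y hy; rewrite sseg //; case: hy => Yy yx h; apply: (mmin y).
by move=> y hy; rewrite sseg //; case: hy => Yy yx; apply: IH.
Qed.

End Cardinals.

(** * Sets smaller than [Y], and splitting large sets *)

Section Small.
Variables (T0 : Type) (Y : set T0).
Hypothesis Yinf : infinite_set Y.

Definition small (T : Type) (Z : set T) : Prop := ~ (Y #<= Z).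

Lemma small_le T U (A : set T) (B : set U) : A #<= B -> small B -> small A.
Proof. by move=> AB sB h; apply: sB; apply: card_le_trans AB. Qed.

Lemma small_sub T (A B : set T) : A `<=` B -> small B -> small A.
Proof. by move=> AB; apply: small_le; apply: subset_card_le. Qed.

Lemma small_finite T (A : set T) : finite_set A -> small A.
Proof. by move=> fA h; apply: Yinf; apply: card_le_finite h fA. Qed.

Lemma small_image T U (f : T -> U) (A : set T) : small A -> small (f @` A).
Proof. by apply: small_le; apply: card_image_le. Qed.

Lemma small_setX T U (A : set T) (B : set U) :
  small A -> small B -> small (A `*` B).
Proof.
move=> sA sB; have [fA|iA] := pselect (finite_set A); last first.
  have [AB|BA] := card_le_total A B.
    have iB : infinite_set B by move=> /(card_le_finite AB).
    apply: small_le sB; apply: card_le_trans (card_sq iB).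
    exact: card_leX.
  apply: small_le sA; apply: card_le_trans (card_sq iA).
  exact: card_leX.
have [fB|iB] := pselect (finite_set B).
  by apply: small_finite; apply: finite_setX.
have AB : A #<= B by apply: card_leNge => /card_le_finite/(_ fA).
apply: small_le sB; apply: card_le_trans (card_sq iB).
exact: card_leX.
Qed.

(** The common bound [M] embeds the union into the product of [I] and [M]. Smallness of the single
    [B i] would not suffice when the cardinality of [Y] is singular. *)
Lemma small_bigcup T U V (I : set T) (B : T -> set U) (M : set V) :
  small I -> small M -> (forall i, I i -> B i #<= M) ->
  small (\bigcup_(i in I) B i).
Proof.
move=> sI sM BM; have [M0|] := pselect (M !=set0); last first.
  move=> M0; suff -> : \bigcup_(i in I) B i = set0 by apply: small_finite.
  apply/seteqP; split=> // x [i Ii Bx].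
  have e : M = set0 by apply/seteqP; split=> // y My; case: M0; exists y.
  by have := BM i Ii; rewrite e => /card_le0P e'; rewrite e' in Bx.
case: M0 => v0 Mv0.
have /choice[f fP] : forall i, exists f : U -> V, I i ->
    (forall x, B i x -> M (f x)) /\
    (forall x y, B i x -> B i y -> f x = f y -> x = y).
  move=> i; have [Ii|nI] := pselect (I i); last by exists (fun=> v0).
  by have [f fP] := card_leE v0 (BM i Ii); exists f.
have [[t0]|nt] := pselect (inhabited T); last first.
  suff -> : \bigcup_(i in I) B i = set0 by apply: small_finite.
  by apply/seteqP; split=> // x [i]; case: nt.
have /choice[g gP] : forall x, exists i, (\bigcup_(i in I) B i) x -> I i /\ B i x.
  move=> x; have [[i Ii Bx]|n] := pselect ((\bigcup_(i in I) B i) x).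
    by exists i.
  by exists t0.
apply: small_le (small_setX sI sM).
apply: (@card_leI _ _ _ _ (fun x => (g x, f (g x) x))).
  by move=> x /gP[Ig Bg]; split=> //=; apply: (fP _ Ig).1.
move=> x y /gP[Ix Bx] /gP[Iy By] [e]; rewrite -e => h.
by apply: (fP _ Ix).2 h => //; rewrite e.
Qed.

(** An infinite [I] is itself a common bound for finite sets. *)
Lemma small_bigcup_finite T U (I : set T) (B : T -> set U) :
  small I -> (forall i, I i -> finite_set (B i)) ->
  small (\bigcup_(i in I) B i).
Proof.
move=> sI fB; have [fI|iI] := pselect (finite_set I).
  by apply: small_finite; apply: bigcup_finite.
apply: (small_bigcup sI sI) => i /fB fBi.
by apply: card_leNge => /card_le_finite/(_ fBi).
Qed.

Lemma small_setU T (A B : set T) : small A -> small B -> small (A `|` B).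
Proof.
move=> sA sB.
have -> : A `|` B = \bigcup_(b in [set: bool]) (if b then A else B).
  apply/seteqP; split=> [x [Ax|Bx]|x [[] _ ]]; [by exists true|by exists false|by left|by right].
have sb : small [set: bool] by apply: small_finite; exact: finite_finset.
have [AB|BA] := card_le_total A B.
  by apply: (small_bigcup sb sB) => -[].
by apply: (small_bigcup sb sA) => -[].
Qed.

Lemma small_bigcup_fin (I : finType) U (B : I -> set U) :
  (forall i, small (B i)) -> small (\bigcup_(i in setT) B i).
Proof.
move=> sB.
have -> : \bigcup_(i in setT) B i = \bigcup_(i in [set` enum I]) B i.
  apply/seteqP; split=> x [i _ Bx]; exists i => //.
  by rewrite /= mem_enum.
elim: (enum I) => [|i s IH].
  by apply: small_finite; rewrite set_nil bigcup_set0.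
apply: small_sub (small_setU (sB i) IH) => x [j /=].
by rewrite inE => /orP[/eqP -> ? |js ?]; [left|right; exists j].
Qed.

Lemma large_setD T (A B : set T) : Y #<= A -> small B -> Y #<= A `\` B.
Proof.
move=> YA sB; apply: contrapT => sD; apply: (small_setU sD sB).
by apply: card_le_trans YA _; apply: subset_card_le => x Ax;
   have [|] := pselect (B x); [right|left].
Qed.

(** A triple of an index, an element of [Y] and a boolean is a request for a point of the indexed
    set. The requests are coded in [Y] and served greedily by distinct points; [J] collects those
    served for [true]. *)
Lemma bisect P V (F : set P) (B : P -> set V) : F #<= Y ->
  (forall p, F p -> Y #<= B p) ->
  exists J : set V, forall p, F p -> Y #<= B p `&` J /\ Y #<= B p `\` J.
Proof.
move=> FY YB; have [[p0 Fp0]|F0] := pselect (F !=set0); last first.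
  by exists set0 => p Fp; case: F0; exists p.
have [y0 Yy0] := infinite_setN0 Yinf.
have [v0 Bv0] : B p0 !=set0.
  apply/set0P/eqP => e; have := YB _ Fp0; rewrite e => /card_le0P Y0.
  by rewrite Y0 in Yy0.
have [lt [w sm]] := cwo_exists Y.
have h2 : F `*` (Y `*` [set: bool]) #<= Y.
  apply: card_le_trans (card_sq Yinf); apply: card_leX => //.
  apply: card_le_trans (card_sq Yinf); apply: card_leX => //.
  apply: card_leNge => /card_le_finite h.
  by apply: Yinf; apply: h; exact: finite_finset.
have [h [hY hinj]] := card_leE y0 h2.
have hX p y b : F p -> Y y -> (F `*` (Y `*` [set: bool])) (p, (y, b)) by [].
(* Points outside the range of [h] decode to a default request, which still asks for a point of a
   large set and so can be served like the others. *)
pose dec y := if pselect (exists q, (F `*` (Y `*` [set: bool])) q /\ h q = y) is left e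
  then projT1 (cid e) else (p0, (y0, true)).
have decK q : (F `*` (Y `*` [set: bool])) q -> dec (h q) = q.
  move=> Fq; rewrite /dec; case: pselect => [e|[]]; last by exists q.
  by case: cid => q' /= [Fq' /hinj]; apply.
have decF y : F (dec y).1.
  rewrite /dec; case: pselect => [e|_] //; by case: cid => q /= [[]].
have [|f [fB finj]] := @greedy_inj _ V v0 lt Y (fun y => B (dec y).1) w.
  by move=> t Yt /(card_le_trans (YB _ (decF t))); apply: sm.
exists (f @` [set y | Y y /\ (dec y).2.2]) => p Fp; split.
  apply: (@card_leI _ _ _ _ (fun y => f (h (p, (y, true))))).
    move=> y Yy; have Yh := hY _ (hX p y true Fp Yy); split.
      by have := fB _ Yh; rewrite decK.
    by exists (h (p, (y, true))) => //; split=> //; rewrite decK.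
  move=> y z Yy Yz /finj-/(_ (hY _ (hX p y true Fp Yy)) (hY _ (hX p z true Fp Yz))).
  by move=> /hinj-/(_ (hX p y true Fp Yy) (hX p z true Fp Yz)) [].
apply: (@card_leI _ _ _ _ (fun y => f (h (p, (y, false))))).
  move=> y Yy; have Yh := hY _ (hX p y false Fp Yy); split.
    by have := fB _ Yh; rewrite decK.
  move=> [z [Yz dz] /finj-/(_ Yz Yh) e].
  by move: dz; rewrite e decK.
move=> y z Yy Yz /finj-/(_ (hY _ (hX p y false Fp Yy)) (hY _ (hX p z false Fp Yz))).
by move=> /hinj-/(_ (hX p y false Fp Yy) (hX p z false Fp Yz)) [].
Qed.

Lemma bisect1 V (B : set V) : Y #<= B -> exists J, J `<=` B /\
  (Y #<= J /\ Y #<= B `\` J).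
Proof.
move=> YB; have [||J hJ] := @bisect unit V setT (fun=> B).
- by apply: card_leNge => /card_le_finite h; apply: Yinf; apply: h; exact: finite_finset.
- by [].
have [h1 h2] := hJ tt I; exists (B `&` J); split; first by move=> x [].
split=> //; apply: card_le_trans h2 _; apply: subset_card_le => x [Bx nJ].
by split=> // -[].
Qed.

Lemma cwo_no_max lt y : cwo lt Y -> Y y -> exists2 z, Y z & lt y z.
Proof.
move=> [w sm] Yy; apply: contrapT => h; apply: (sm y Yy).
have sub : Y `<=` seg lt Y y `|` [set y].
  move=> z Yz; have [->|l|l] := wo_total w Yz Yy; [by right|by left|].
  by case: h; exists z.
apply: card_le_trans (subset_card_le sub) _; apply: card_le_setU1 => fin.
by apply: Yinf; apply: sub_finite_set sub _; rewrite finite_setU.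
Qed.

End Small.

(** * Spines *)

Definition is_lim (T : Type) (lt : T -> T -> Prop) (S : set T) (s : T) : Prop :=
  [/\ S s, exists2 u, S u & lt u s &
      forall u, S u -> lt u s -> exists w, [/\ S w, lt u w & lt w s]].

(* The skeleton of a concentrated path: only the limit vertices [v s] matter,
   because star-linkedness provides the remaining connections.  Position [s]
   stands for the finite block [m s] of vertices of the main class. *)
Record spine (T V : Type) (e : T -> V -> Prop) (A : set T) (J : set V)
    (S : set T) (lt : T -> T -> Prop) (v : T -> V) (m : T -> set T) : Prop :=
  Spine {
    spine_wo : wo lt S;
    spine_blk : forall s, S s -> m s `<=` A;
    spine_fin : forall s, S s -> finite_set (m s);
    spine_self : forall s, S s -> m s s;
    spine_disj : forall s t x, S s -> S t -> m s x -> m t x -> s = t;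
    spine_limJ : forall s, is_lim lt S s -> J (v s);
    spine_limE : forall s, is_lim lt S s -> exists2 y, m s y & e y (v s);
    spine_limC : forall s u, is_lim lt S s -> S u -> lt u s ->
      exists w y, [/\ S w, u = w \/ lt u w, lt w s, m w y & e y (v s)];
    spine_inj : forall s t, is_lim lt S s -> is_lim lt S t -> v s = v t -> s = t
  }.

Definition last_of (T : Type) (lt : T -> T -> Prop) (S : set T) (q : T) : Prop :=
  S q /\ forall s, S s -> s = q \/ lt s q.

Section Spines.
Variables (T V : Type).
Implicit Types (e : T -> V -> Prop) (A S : set T) (J : set V).

Lemma spine_sub e A J S lt v m : spine e A J S lt v m -> S `<=` A.
Proof. by move=> sp s Ss; apply: (spine_blk sp Ss); apply: spine_self sp _ Ss. Qed.

Lemma spine_mono e A J A' J' S lt v m : A `<=` A' -> J `<=` J' ->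
  spine e A J S lt v m -> spine e A' J' S lt v m.
Proof.
move=> AA JJ [w b f sf d lJ lE lC i]; split=> //.
- by move=> s Ss; apply: subset_trans AA; apply: b.
- by move=> s /lJ/JJ.
Qed.

Lemma lim_init lt S S' s : S' `<=` S ->
  (forall x y, S' x -> S y -> lt y x -> S' y) ->
  is_lim lt S' s -> is_lim lt S s.
Proof.
move=> SS down [Ss [u Su us] h]; split; [exact: SS|by exists u => //; apply: SS|].
move=> x Sx xs; have [w [Sw xw ws]] := h x (down _ _ Ss Sx xs) xs.
by exists w; split=> //; apply: SS.
Qed.

(** In a downward closed part every point keeps its predecessors, so limits of the part are old
    limits and their witnesses remain. *)
Lemma spine_init e A J S S' lt v m : S' `<=` S ->
  (forall x y, S' x -> S y -> lt y x -> S' y) ->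
  spine e A J S lt v m -> spine e A J S' lt v m.
Proof.
move=> SS down [w b f sf d lJ lE lC i].
have l s := @lim_init lt S S' s SS down.
split.
- exact: wo_sub w SS.
- by move=> s /SS; apply: b.
- by move=> s /SS; apply: f.
- by move=> s /SS; apply: sf.
- by move=> s t x /SS Ss /SS St; apply: d.
- by move=> s /l; apply: lJ.
- by move=> s /l; apply: lE.
- move=> s u ls Su us; have [w' [y [Sw uw ws mw ey]]] := lC _ _ (l _ ls) (SS _ Su) us.
  exists w', y; split=> //; apply: (down _ _ _ Sw ws).
  by case: ls.
- by move=> s t /l ls /l lt'; apply: i.
Qed.

(** Puts [q] on top of [S], with [x] as its limit vertex in case [q] is a limit. The last hypothesis
    provides the cofinal neighbours needed then. *)
Lemma spine_close e A J S lt v m (q : T) (x : V) :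
  spine e A J S lt v m -> A q -> J x -> e q x ->
  (forall s, S s -> ~ m s q) -> (forall s, S s -> v s <> x) ->
  (forall u, S u -> exists w y, [/\ S w, u = w \/ lt u w, m w y & e y x]) ->
  exists lt' v' m', spine e A J (S `|` [set q]) lt' v' m' /\
    last_of lt' (S `|` [set q]) q.
Proof.
move=> [w b f sf d lJ lE lC i] Aq Jx eqx mq vx cof; have [ir tr mn] := w.
have nSq : ~ S q by move=> Sq; apply: (mq q Sq); apply: sf.
(* [lt] is restricted to [S] first, since its behaviour at [q] is unknown. *)
pose lt' a c := [/\ S a, S c & lt a c] \/ (S a /\ c = q).
pose v' a := if pselect (a = q) then x else v a.
pose m' a := if pselect (a = q) then [set q] else m a.
have v'q : v' q = x by rewrite /v'; case: pselect.
have m'q : m' q = [set q] by rewrite /m'; case: pselect.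
have ne s : S s -> s <> q by move=> Ss e'; apply: nSq; rewrite -e'.
have v'S s : S s -> v' s = v s.
  by move=> Ss; rewrite /v'; case: pselect => // e'; case: (ne s Ss).
have m'S s : S s -> m' s = m s.
  by move=> Ss; rewrite /m'; case: pselect => // e'; case: (ne s Ss).
have ltS a c : S c -> lt' a c -> S a /\ lt a c.
  by move=> Sc [[]//|[_ e']]; case: (ne c Sc).
have limS s : S s -> is_lim lt' (S `|` [set q]) s -> is_lim lt S s.
  move=> Ss [_ [u _ us] h]; have [Su lus] := ltS _ _ Ss us.
  split=> //; first by exists u.
  move=> y Sy ys; have [||z [_ yz zs]] := h y; [by left|by left|].
  have [Sz lzs] := ltS _ _ Ss zs; exists z; split=> //.
  by case: (ltS _ _ Sz yz).
exists lt', v', m'; split; last first.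
  by split; [right|move=> s [Ss|->]; [right; right|left]].
split.
- split.
  + move=> a [Sa|->]; first by case/(ltS _ _ Sa) => _; apply: ir.
    by case=> [[Sq]|[Sq]].
  + move=> a y z _ _ [Sz|->].
      move=> ay /(ltS _ _ Sz)[Sy yz]; have [Sa lay] := ltS _ _ Sy ay.
      by left; split=> //; apply: tr yz.
    by case=> [[Sa _ _]|[Sa _]] _; right.
  + move=> Z ZS [z0 Zz0]; have [[z1 [Sz1 Zz1]]|nS] := pselect ((S `&` Z) !=set0).
      have [||z [[Sz Zz] h]] := mn (S `&` Z); [by move=> z []|by exists z1|].
      exists z; split=> // s Zs; case: (ZS s Zs) => [Ss|->]; last by right; right.
      by have [->|l] := h s (conj Ss Zs); [left|right; left].
    have ZE s : Z s -> s = q.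
      by move=> Zs; case: (ZS s Zs) => // Ss; case: nS; exists s.
    by exists z0; split=> // s /ZE ->; rewrite (ZE _ Zz0); left.
- by move=> s [Ss|->]; [rewrite m'S //; apply: b|rewrite m'q => _ ->].
- by move=> s [Ss|->]; [rewrite m'S //; apply: f|rewrite m'q].
- by move=> s [Ss|->]; [rewrite m'S //; apply: sf|rewrite m'q].
- move=> s t y [Ss|->] [St|->] //; rewrite ?m'q ?m'S //.
  + exact: d.
  + by move=> h /= e'; case: (mq s Ss); rewrite -e'.
  + by move=> /= -> /(mq t St).
- move=> s ls; have [[Ss|->] _ _] := ls; last by rewrite v'q.
  by rewrite v'S //; apply: lJ; apply: limS.
- move=> s ls; have [[Ss|->] _ _] := ls; last by rewrite v'q m'q; exists q.
  by rewrite v'S // m'S //; apply: lE; apply: limS.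
- move=> s u ls Su us; have [[Ss|es] _ _] := ls.
    have [Su' lus] := ltS _ _ Ss us.
    have [w' [y [Sw uw ws mw ey]]] := lC _ _ (limS _ Ss ls) Su' lus.
    exists w', y; split; [by left| |by left|by rewrite m'S|by rewrite v'S].
    by case: uw; [left|right; left].
  have {}es : s = q := es; subst s; have Su' : S u by case: us => [[]//|[]].
  have [w' [y [Sw uw mw ey]]] := cof u Su'.
  exists w', y; split; [by left| |by right|by rewrite m'S|by rewrite v'q].
  by case: uw; [left|right; left].
- move=> s t ls lt0; have [[Ss|->] _ _] := ls; have [[St|->] _ _] := lt0;
    rewrite ?v'q ?v'S // => e'.
  + by apply: i e'; apply: limS.
  + by case: (vx s Ss).
  + by case: (vx t St).
Qed.

End Spines.

(** * Spines with a last element in complete bipartite graphs *)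

Section Closed.
Variables (T V : Type) (r : nat) (E : 'I_r -> T -> V -> Prop).
Implicit Types (C : {set 'I_r}) (Y : set T) (J : set V).

Definition complete C Y J : Prop :=
  forall y v, Y y -> J v -> exists2 k, k \in C & E k y v.

Definition has_spine C Y J : Prop :=
  exists k S lt v m,
    [/\ k \in C, spine (E k) Y J S lt v m & Y #<= S].

Definition spinable Y : Prop := forall J C,
  Y #<= J -> complete C Y J -> has_spine C Y J.

Lemma complete_sub C Y J Y' J' : Y' `<=` Y -> J' `<=` J ->
  complete C Y J -> complete C Y' J'.
Proof. by move=> YY JJ h y v /YY Yy /JJ Jv; apply: h. Qed.

(** Reduce the colours until no colour can be avoided, on a set of size |[Y1]|, by more than |[Y1]|
    vertices. Then |[Y1]| exceptional sets of at most that size cannot exhaust the larger set [J],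
    and some [x] has neighbours, in the colour of the spine, in every tail of it and at a vertex [q]
    outside. *)
Lemma closed_spine Y1 J C : infinite_set Y1 ->
  (forall Y', Y' #<= Y1 -> Y1 #<= Y' -> spinable Y') ->
  complete C Y1 J -> ~ (J #<= Y1) ->
  exists k S lt v m q, [/\ k \in C, spine (E k) Y1 J S lt v m,
    Y1 #<= S & last_of lt S q].
Proof.
move=> inf IH cm nJ.
suff main n : forall C Y' J', (#|C| <= n)%N -> Y' `<=` Y1 -> Y1 #<= Y' ->
    ~ (J' #<= Y1) -> complete C Y' J' ->
    exists k S lt v m q, [/\ k \in C, spine (E k) Y' J' S lt v m,
    Y1 #<= S & last_of lt S q].
  exact: (main #|C| C Y1 J).
clear C J cm nJ; elim: n => [|n IHn] C Y J Cn YY1 Y1Y nJ cm.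
  have [y0 Yy0] : Y !=set0.
    apply/set0P/eqP => e; apply: inf; apply: card_le_finite Y1Y _.
    by rewrite e.
  have [j0 Jj0] : J !=set0.
    by apply/set0P/eqP => e; apply: nJ; rewrite e; apply: card_ge0.
  have [k] := cm _ _ Yy0 Jj0.
  by move: Cn; rewrite leqn0 cards_eq0 => /eqP ->; rewrite finset.in_set0.
have [[k [Y' [J' [kC [Y'Y Y1Y' J'J nJ' cm']]]]]|nred] :=
  pselect (exists k Y' J', k \in C /\ [/\ Y' `<=` Y, Y1 #<= Y', J' `<=` J,
    ~ (J' #<= Y1) & complete (C :\ k) Y' J']).
  have [||k' [S [lt [v [m [q [k'C sp YS la]]]]]]] := IHn (C :\ k) Y' J' _ _ Y1Y' nJ' cm'.
  - by rewrite -ltnS; apply: leq_trans Cn; rewrite (cardsD1 k C) kC.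
  - exact: subset_trans YY1.
  exists k', S, lt, v, m, q; split=> //.
    by move: k'C; rewrite in_setD1 => /andP[].
  exact: spine_mono sp.
have min k Y' : k \in C -> Y' `<=` Y -> Y1 #<= Y' ->
    [set v | J v /\ forall y, Y' y -> ~ E k y v] #<= Y1.
  move=> kC Y'Y Y1Y'; apply: contrapT => nJ'; apply: nred.
  exists k, Y', [set v | J v /\ forall y, Y' y -> ~ E k y v]; split=> //.
  split=> //; first by move=> v [].
  move=> y v Y'y [Jv nE]; have [k' k'C Ek'] := cm y v (Y'Y _ Y'y) Jv.
  exists k' => //; rewrite in_setD1 k'C andbT; apply/eqP => e.
  by apply: (nE y Y'y); rewrite -e.
(* [Ya] hosts the spine; [Yb] is kept free for the last element. *)
have [Ya [YaY [Y1Ya Y1Yb]]] := bisect1 inf Y1Y.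
set Yb := Y `\` Ya in Y1Yb.
have YaY1 : Ya #<= Y1 by apply: subset_card_le; apply: subset_trans YY1.
have [||k [S0 [lt [v [m [kC sp0 YaS0]]]]]] := IH Ya YaY1 Y1Ya J C.
- by apply: card_le_trans YaY1 _; apply: card_leNge.
- by apply: complete_sub cm.
have w0 := spine_wo sp0.
have {YaS0} Y1S0 := card_le_trans Y1Ya YaS0.
(* pass to an initial segment of cardinal type, so that all tails are large *)
have [S [sp Y1S Sini]] : exists S, [/\ spine (E k) Ya J S lt v m,
    Y1 #<= S & forall s, S s -> ~ (Y1 #<= seg lt S s)].
  have [h|] := pselect (forall s, S0 s -> ~ (Y1 #<= seg lt S0 s)); first by exists S0.
  move=> /existsNP[x0 /not_implyP[S0x0 /contrapT h0]].
  have [||x [[S0x hx] xmin]] := @wo_min _ _ _ [set x | S0 x /\ Y1 #<= seg lt S0 x] w0.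
  - by move=> x [].
  - by exists x0.
  exists (seg lt S0 x); split=> //.
    apply: spine_init sp0; first exact: seg_sub.
    move=> a b [S0a ax] S0b ba; split=> //.
    by apply: (wo_lt_le w0 _ _ _ ba); auto.
  move=> s [S0s sx] hs; apply: (xmin s) => //; split=> //.
  apply: card_le_trans hs _; apply: subset_card_le => z [[S0z _] zs].
  by split.
clear S0 w0 sp0 Y1S0; have wS := spine_wo sp.
have SYa := spine_sub sp.
have tail u : S u -> Y1 #<= S `&` [set s | u = s \/ lt u s].
  move=> Su; apply: card_le_trans (large_setD inf Y1S (Sini u Su)) _.
  apply: subset_card_le => s [Ss ns]; split=> //.
  have [->|us|su] := wo_total wS Su Ss; [by left|by right|].
  by case: ns; split.
pose Exc u := [set x | J x /\ forall y, (S `&` [set s | u = s \/ lt u s]) y -> ~ E k y x].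
have ExcS u : S u -> Exc u #<= Y1.
  move=> Su; apply: min => //; last exact: tail.
  by move=> y [Sy _]; apply/YaY/SYa.
pose ExcB := [set x | J x /\ forall y, Yb y -> ~ E k y x].
have ExcBS : ExcB #<= Y1.
  by apply: min => // y [].
have SY1 : S #<= Y1 by apply: subset_card_le; apply: subset_trans YY1; apply: subset_trans YaY.
have [Jinf|Jfin] := pselect (infinite_set J); last first.
  by case: nJ; apply: card_leNge => /card_le_finite h; apply: inf; apply: h; apply: contrapT.
have sm U (A : set U) : A #<= Y1 -> small J A.
  by move=> h1 h2; apply: nJ; apply: card_le_trans h1.
have smbad : small J (((\bigcup_(u in S) Exc u) `|` ExcB) `|` v @` S).
  apply: small_setU => //; last by apply: small_image; apply: sm.
  apply: small_setU => //; last exact: sm.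
  by apply: (@small_bigcup _ _ Jinf _ _ _ S Exc Y1) => //; apply: sm => //; exact: card_lexx.
have [x [Jx nx]] : exists x, J x /\ ~ (((\bigcup_(u in S) Exc u) `|` ExcB) `|` v @` S) x.
  apply: contrapT => h; apply: smbad; apply: subset_card_le => x Jx.
  by apply: contrapT => nx; apply: h; exists x.
have [q [Ybq Eqx]] : exists q, Yb q /\ E k q x.
  apply: contrapT => h; apply: nx; left; right; split=> // y Yby Ey.
  by apply: h; exists y.
have [|||||||lt' [v' [m' [sp' la]]]] := @spine_close _ _ (E k) Y J S lt v m q x.
- exact: spine_mono sp.
- by case: Ybq.
- by [].
- by [].
- by move=> s Ss /(spine_blk sp Ss); case: Ybq.
- by move=> s Ss e; apply: nx; right; exists s.
- move=> u Su; apply: contrapT => h; apply: nx; left; left; exists u => //.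
  split=> // y [Sy uy] Ey; apply: h; exists y, y; split=> //.
  exact: spine_self sp _ Sy.
exists k, (S `|` [set q]), lt', v', m', q; split=> //.
by apply: card_le_trans Y1S _; apply: subset_card_le => ? ?; left.
Qed.

End Closed.

(** * Half graphs *)

Section Helpers.
Variable T : Type.
Implicit Types (lt : T -> T -> Prop) (S Y : set T).

Lemma finite_last lt S : wo lt S -> finite_set S -> S !=set0 ->
  exists q, last_of lt S q.
Proof.
move=> w fin [x0 Sx0]; apply: contrapT => nl.
have /choice[g gP] : forall x, exists y, S x -> S y /\ lt x y.
  move=> x; have [Sx|] := pselect (S x); last by exists x.
  have [[y [Sy xy]]|n] := pselect (exists y, S y /\ lt x y); first by exists y.
  case: nl; exists x; split=> // s Ss.
  have [->|xs|] := wo_total w Sx Ss; [by left| |by right].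
  by case: n; exists s.
pose f n := iter n g x0.
have fS n : S (f n) by elim: n => //= n IH; have [] := gP _ IH.
have fl n d : lt (f n) (f (n + d.+1)%N).
  elim: d => [|d IH]; first by rewrite addn1; have [] := gP _ (fS n).
  rewrite addnS; have [_ tr _] := w.
  by apply: tr IH _ => //; have [] := gP _ (fS (n + d.+1)%N).
have [ir _ _] := w.
have finj m n : (m < n)%N -> f m <> f n.
  move=> mn e; apply: (ir _ (fS m)).
  by rewrite {2}e -(subnKC mn) addSnnS; apply: fl.
have /infiniteP : [set: nat] #<= S.
  apply: (@card_leI _ _ _ _ f) => // m n _ _ e.
  by case: (ltngtP m n) => // h; [case: (finj _ _ h)|case: (finj _ _ h)].
exact.
Qed.

Lemma finite_nlim lt S s : wo lt S -> finite_set S -> ~ is_lim lt S s.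
Proof.
move=> w fin [Ss [u Su us] h].
have [|||q [[Sq qs] ql]] := @finite_last lt (seg lt S s).
- exact: wo_sub w (@seg_sub _ _ _ _).
- exact: sub_finite_set (@seg_sub _ _ _ _) fin.
- by exists u.
have [x [Sx qx xs]] := h q Sq qs.
have [ir _ _] := w.
have [e|xq] := ql x (conj Sx xs); first by apply: (ir q) => //; rewrite -{2}e.
exact: (wo_asym w Sq Sx qx).
Qed.

Lemma finite_subsingleton (A : set T) :
  (forall x y, A x -> A y -> x = y) -> finite_set A.
Proof.
move=> h; have [[x Ax]|n] := pselect (A !=set0).
  by apply: sub_finite_set (finite_set1 x) => y Ay; apply: h.
suff -> : A = set0 by [].
by apply/seteqP; split=> // x Ax; case: n; exists x.
Qed.

(* The initial segment before the least limit position preceded by at least |Z|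
   elements has size |Z|, and that position closes it. *)
Lemma spine_truncate V (e : T -> V -> Prop) (A : set T) J S lt v m q
    (U : Type) (Z : set U) :
  infinite_set Z -> spine e A J S lt v m -> last_of lt S q -> Z #<= S ->
  exists S' q', [/\ spine e A J S' lt v m, last_of lt S' q', Z #<= S' & S' #<= Z].
Proof.
move=> inf sp la ZS; have w := spine_wo sp.
have [[x0 [Sx0 h0]]|n] := pselect (exists x, S x /\ Z #<= seg lt S x); last first.
  exists S, q; split=> //; apply: contrapT => /(card_le_seg w)[x Sx hx].
  by apply: n; exists x.
have [||x [[Sx hx] xmin]] := @wo_min _ _ _ [set x | S x /\ Z #<= seg lt S x] w.
- by move=> x [].
- by exists x0.
have wsg : wo lt (seg lt S x) by apply: wo_sub w (@seg_sub _ _ _ _).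
exists (seg lt S x `|` [set x]), x; split.
- apply: spine_init sp; first by move=> y [[]|->].
  move=> a b [[Sa ax]|->] Sb ba; left; split=> //.
  by apply: (wo_lt_le w _ _ _ ba); auto.
- by split; [right|move=> s [[Ss sx]|->]; [right|left]].
- by apply: card_le_trans hx _; apply: subset_card_le; left.
apply: card_le_trans (_ : _ #<= seg lt S x) _.
  by apply: card_le_setU1 => /(card_le_finite hx).
apply: contrapT => /(card_le_seg wsg)[y [Sy yx] hy].
apply: (xmin y) => //; split=> //; apply: card_le_trans hy _.
by apply: subset_card_le => z [[Sz _] zy].
Qed.

Lemma wo_rec_pred lt Y (F : T -> set T -> Prop) : wo lt Y ->
  exists X : set T, X `<=` Y /\ forall t, Y t ->
    (X t <-> F t (X `&` seg lt Y t)).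
Proof.
move=> w; have [[t0]|nT] := pselect (inhabited T); last first.
  by exists set0; split=> // t; case: nT.
(* [greedy] passes on only a set of values, so each value carries its own argument: the pair of [s]
   and [true] records that [s] belongs to the set. *)
pose P t (S : set (T * bool)) (d : T * bool) :=
  d.1 = t /\ (d.2 = `[< F t [set s | S (s, true)] >]).
have [|f fP] := @greedy T (T * bool) (t0, true) lt Y P w.
  by move=> t S _ _; exists (t, `[< F t [set s | S (s, true)] >]).
exists [set t | Y t /\ (f t).2]; split=> [t []//|t Yt].
have [e1 e2] := fP t Yt.
have -> : [set t | Y t /\ (f t).2] `&` seg lt Y t =
   [set s | (f @` seg lt Y t) (s, true)].
  apply/seteqP; split=> s.
    move=> [[_ fs2] [Ys st]]; exists s => //.
    have [fs1 _] := fP s Ys.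
    by case: (f s) fs1 fs2 => a b /= -> ->.
  move=> [s' [Ys' st'] e]; have [fs1 _] := fP s' Ys'.
  by move: fs1; rewrite e /= => es; subst s'; split=> //; split=> //; rewrite e.
rewrite /= e2; split=> [[_ /asboolP]//|h]; split=> //; exact/asboolP.
Qed.

(* Iterating an increasing map [h], with suprema at limits, cuts [Y] into
   consecutive intervals [t, h t); the end points form the closed set [X]. *)
Lemma closed_chain lt Y (h : T -> T) : wo lt Y ->
  (forall x, Y x -> Y (h x) /\ lt x (h x)) ->
  exists X : set T, [/\ X `<=` Y,
    forall s t, X s -> X t -> lt s t -> h s = t \/ lt (h s) t
  & forall x, Y x -> exists t, [/\ X t, t = x \/ lt t x & lt x (h t)]].
Proof.
move=> w hY; have [ir tr mn] := w.
(* A point enters [X] exactly when it is the least upper bound of [h s] over the earlier [s] in [X];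
   for the least element of [Y] this is vacuous. *)
pose F t (X : set T) :=
  (forall s, X s -> lt s t -> h s = t \/ lt (h s) t) /\
  (forall g, Y g -> lt g t -> exists s, [/\ X s, lt s t & lt g (h s)]).
have [X [XY XP]] := wo_rec_pred F w.
have X1 s t : X s -> X t -> lt s t -> h s = t \/ lt (h s) t.
  move=> Xs Xt st; have [/(_ Xt)[h1 _] _] := XP t (XY _ Xt).
  by apply: h1 => //; split=> //; split=> //; apply: XY.
exists X; split=> // x Yx; apply: contrapT => n.
have hle t : X t -> t = x \/ lt t x -> h t = x \/ lt (h t) x.
  move=> Xt tx; have [Yht _] := hY t (XY _ Xt).
  have nl : ~ lt x (h t) by move=> l; apply: n; exists t.
  exact: wo_nlt w Yx Yht nl.
(* If no interval contained [x], the least bound [b] of the values [h t], for [t] in [X] up to [x],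
   would itself satisfy the rule. Then [b] is in [X] and [h b] is at most [b], which is absurd. *)
pose B := [set b | Y b /\ forall t, X t -> t = x \/ lt t x -> h t = b \/ lt (h t) b].
have [||b [[Yb hb] bmin]] := @wo_min _ _ _ B w; first by move=> b [].
  by exists x; split.
have bx : b = x \/ lt b x.
  by apply: (wo_nlt w) => // xb; apply: (bmin x).
have Xb : X b.
  apply/(XP b Yb); split.
    move=> s [Xs [Ys sb]] _; apply: hb => //; right.
    exact: (wo_lt_le w _ _ _ sb bx).
  move=> g Yg gb; have nB : ~ B g by move=> Bg; apply: (bmin g).
  apply: contrapT => ns; apply: nB; split=> // t Xt tx.
  have [Yht tht] := hY t (XY _ Xt).
  apply: (wo_nlt w) => // gh; apply: ns; exists t.
  have tb : lt t b by apply: (wo_lt_le w _ _ _ tht (hb t Xt tx)) => //; apply: XY.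
  by split=> //; split=> //; split=> //; apply: XY.
have [Yhb bhb] := hY b Yb.
have [e|l] := hb b Xb bx; first by apply: (ir b) => //; rewrite -{2}e.
exact: (wo_asym w Yb Yhb bhb).
Qed.

Lemma wo_max2 lt Y a b : wo lt Y -> Y a -> Y b ->
  exists c, [/\ Y c, a = c \/ lt a c & b = c \/ lt b c].
Proof.
move=> w Ya Yb; have [<-|ab|ba] := wo_total w Ya Yb.
- by exists a; split=> //; left.
- by exists b; split=> //; [right|left].
- by exists a; split=> //; [left|right].
Qed.

End Helpers.

(** The spine built for one interval of the chain, with a limit vertex [pc_u] for its first position
    and a neighbour [pc_x] of that vertex inside the interval; bundled so that [greedy] can choose
    it as one value. *)
Record piece (T V : Type) : Type := Piece {
  pc_x : T; pc_u : V; pc_S : set T; pc_lt : T -> T -> Prop;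
  pc_v : T -> V; pc_m : T -> set T; pc_q : T
}.

Section HalfGraph.
Variables (T V : Type) (r : nat) (E : 'I_r -> T -> V -> Prop).
Variables (lt : T -> T -> Prop) (Y : set T) (J : set V).
Hypotheses (Yinf : infinite_set Y) (Ycwo : cwo lt Y).
Implicit Types (C : {set 'I_r}) (A : set T).

Let Ywo : wo lt Y := Ycwo.1.

(** [J] carries no order. Lying above [y] is replaced by having [C]-coloured edges to all of [A]
    below [y]; asking only that these sets be large makes the notion stable under deleting small
    sets. *)
Definition above C A (y : T) : set V :=
  [set v | J v /\ forall z, A z -> lt z y -> exists2 k, k \in C & E k z v].

Definition half_graph C A : Prop :=
  [/\ A `<=` Y, Y #<= A & forall y, Y y -> Y #<= above C A y].

Definition unavoidable C A : Prop :=
  forall k A', k \in C -> A' `<=` A -> Y #<= A' -> exists y, Y y /\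
    small Y [set v | above C A y v /\ forall z, A' z -> lt z y -> ~ E k z v].

(** A failure of [unavoidable] at [k] and [A'] makes [A'] a half graph in the remaining colours, so
    removing colours must end at an unavoidable set. *)
Lemma half_graph_minimal C : half_graph C Y ->
  exists C0 A, [/\ C0 \subset C, half_graph C0 A & unavoidable C0 A].
Proof.
suff main n C1 A0 : (#|C1| <= n)%N -> half_graph C1 A0 ->
    exists C0 A, [/\ C0 \subset C1, half_graph C0 A & unavoidable C0 A].
  exact: (main #|C|).
elim: n C1 A0 => [|n IH] C1 A0 C1n hg.
  exists C1, A0; split=> // k A' kC; move: C1n; rewrite leqn0 cards_eq0 => /eqP e.
  by move: kC; rewrite e finset.in_set0.
have [u|] := pselect (unavoidable C1 A0); first by exists C1, A0.
move=> /existsNP[k /existsNP[A' /not_implyP[kC /not_implyP[A'A /not_implyP[YA' nex]]]]].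
have [||C0 [A [C0C hgA uA]]] := IH (C1 :\ k) A'.
- by rewrite -ltnS; apply: leq_trans C1n; rewrite (cardsD1 k C1) kC.
- have [A0Y YA0 hab] := hg; split=> //; first exact: subset_trans A0Y.
  move=> y Yy; apply: contrapT => sm; apply: nex; exists y; split=> //.
  apply: small_sub sm => v [[Jv vP] nE]; split=> // z A'z zy.
  have [k' k'C Ek'] := vP z (A'A _ A'z) zy.
  exists k' => //; rewrite in_setD1 k'C andbT; apply/eqP => e.
  by apply: (nE z A'z zy); rewrite -e.
exists C0, A; split=> //; apply: fintype.subset_trans C0C _.
by apply/fintype.subsetP => x; rewrite in_setD1 => /andP[].
Qed.

Hypothesis Yind : forall Y', infinite_set Y' -> small Y Y' -> spinable E Y'.

(** * Pieces along a closed chain and their concatenation *)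

Section Minimal.
Variables (C : {set 'I_r}) (A A0 A1 : set T).
Hypotheses (hgA : half_graph C A) (unA : unavoidable C A).
Hypotheses (A0A : A0 `<=` A) (YA0 : Y #<= A0).
Hypotheses (A1A : A1 `<=` A) (YA1 : Y #<= A1).
Hypothesis A01 : forall x, A0 x -> A1 x -> False.

Let AY : A `<=` Y := let: And3 h _ _ := hgA in h.

Lemma small_seg y : Y y -> small Y (seg lt Y y).
Proof. exact: Ycwo.2. Qed.

Lemma large_nonempty U (B : set U) : Y #<= B -> B !=set0.
Proof.
move=> h; apply/set0P/eqP => e; apply: Yinf; apply: card_le_finite h _.
by rewrite e.
Qed.

Lemma above_anti y y' : Y y -> Y y' -> y = y' \/ lt y y' ->
  above C A y' `<=` above C A y.
Proof.
move=> Yy Yy' yy v [Jv vP]; split=> // z Az zy; apply: vP => //.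
by apply: (wo_lt_le Ywo _ _ _ zy yy) => //; apply: AY.
Qed.

(** [Es] and [Ej] are the vertices already in use. The upper bound on [S] keeps the vertices used by
    earlier pieces under a common bound. *)
Definition segment_for (k : 'I_r) (Z Es : set T) (Ej : set V) : Prop :=
  exists S lt' v m q, [/\ spine (E k) (A1 `\` Es) (J `\` Ej) S lt' v m,
    last_of lt' S q, Z #<= S & S #<= Z].

(** A copy of [Z] inside [A1] fits below one point [x]. The vertices above [x] are completely joined
    to this copy and outnumber it, so [closed_spine] applies. *)
Lemma segment_some (Z Es : set T) (Ej : set V) : infinite_set Z ->
  small Y Z -> small Y Es -> small Y Ej ->
  exists k S lt' v m q, [/\ k \in C, spine (E k) (A1 `\` Es) (J `\` Ej) S lt' v m,
    last_of lt' S q & Z #<= S].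
Proof.
move=> Zinf sZ sEs sEj.
have YB := large_setD Yinf YA1 sEs; set B := A1 `\` Es in YB.
have BY : B `<=` Y by move=> x [/A1A/AY].
have [|x Bx Zx] := @card_le_seg _ _ lt B Z (wo_sub Ywo BY).
  by move=> h; apply: sZ; apply: card_le_trans YB h.
have Yx := BY x Bx.
have [z0 Zz0] := infinite_setN0 Zinf.
have [g [gB ginj]] := card_leE x Zx.
pose Y1 := g @` Z.
have Y1Z : Y1 #<= Z by apply: card_image_le.
have ZY1 : Z #<= Y1 by apply: (@card_leI _ _ _ _ g) => // z Zz; exists z.
have Y1inf : infinite_set Y1 by move=> /(card_le_finite ZY1).
have [_ _ hab] := hgA.
have YJ1 := large_setD Yinf (hab x Yx) sEj; set J1 := _ `\` _ in YJ1.
have cm : complete E C Y1 J1.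
  move=> _ v [z Zz <-] [[Jv vP] _]; have [[/A1A Ag _] gx] := gB z Zz.
  exact: vP.
have nJ1 : ~ (J1 #<= Y1).
  by move=> h; apply: sZ; apply: card_le_trans YJ1 (card_le_trans h Y1Z).
have [|k [S [lt' [v [m [q [kC sp Y1S la]]]]]]] := closed_spine Y1inf _ cm nJ1.
  move=> Y' Y'Y1 Y1Y'; apply: Yind; first by move=> /(card_le_finite Y1Y').
  by apply: small_le sZ; apply: card_le_trans Y'Y1 Y1Z.
exists k, S, lt', v, m, q; split=> //.
- apply: spine_mono sp; first by move=> _ [z Zz <-]; have [] := gB z Zz.
  by move=> v' [[]].
- exact: card_le_trans ZY1 Y1S.
Qed.

(** A finite well-order has no limits, so every colour works and the limit vertices may be
    constant. *)
Lemma segment_finite k Z Es Ej : finite_set Z -> Z !=set0 -> small Y Es ->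
  segment_for k Z Es Ej.
Proof.
move=> fin [z0 Zz0] sEs.
have YB := large_setD Yinf YA1 sEs; set B := A1 `\` Es in YB.
have ZB : Z #<= B by apply: card_le_trans YB; apply: card_leNge; apply: small_finite.
have [y0 By0] := large_nonempty YB.
have [v0 _] : J !=set0.
  have [_ _ hab] := hgA; have [v [Jv _]] := large_nonempty (hab y0 (AY (A1A By0.1))).
  by exists v.
have [g [gB ginj]] := card_leE y0 ZB.
have wS : wo lt (g @` Z).
  by apply: wo_sub Ywo _ => _ [z /gB[/A1A/AY Yg _] <-].
have finS : finite_set (g @` Z) by apply: finite_image.
have [|q la] := finite_last wS finS; first by exists (g z0); exists z0.
exists (g @` Z), lt, (fun=> v0), (fun s => [set s]), q; split=> //.
- have nl s := @finite_nlim _ lt (g @` Z) s wS finS.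
  split=> //.
  + by move=> s [z /gB Bg <-] _ ->.
  + by move=> s t x _ _ -> ->.
  + by move=> s /nl.
  + by move=> s /nl.
  + by move=> s u /nl.
  + by move=> s t /nl.
- by apply: (@card_leI _ _ _ _ g) => // z Zz; exists z.
- exact: card_image_le.
Qed.

(** If every colour had a counterexample, the union of these finitely many ones would defeat all
    colours at once, against [segment_some]. The spine obtained for the union is truncated to the
    size of the single counterexample. *)
Lemma segment_colour : exists2 k, k \in C & forall Z Es Ej, Z !=set0 ->
  small Y Z -> small Y Es -> small Y Ej -> segment_for k Z Es Ej.
Proof.
apply: contrapT => n.
have /choice[Zf] : forall k, exists Z : set T, exists Es Ej, [/\ small Y Z, small Y Es,
    small Y Ej, k \in C -> Z !=set0 & k \in C -> ~ segment_for k Z Es Ej].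
  move=> k; have s0 U : small Y (@set0 U) by apply: small_finite.
  have [kC|nk] := boolP (k \in C); last by exists set0, set0, set0; split.
  apply: contrapT => n'; apply: n; exists k => // Z Es Ej Z0 sZ sEs sEj.
  by apply: contrapT => ns; apply: n'; exists Z, Es, Ej; split.
move=> /choice[Ef] /choice[Jf] f.
pose Zu := \bigcup_(k in setT) Zf k.
pose Eu := \bigcup_(k in setT) Ef k.
pose Ju := \bigcup_(k in setT) Jf k.
have sZ : small Y Zu by apply: small_bigcup_fin => // k; have [] := f k.
have sE : small Y Eu by apply: small_bigcup_fin => // k; have [] := f k.
have sJ : small Y Ju by apply: small_bigcup_fin => // k; have [] := f k.
have mono k S lt' v m : spine (E k) (A1 `\` Eu) (J `\` Ju) S lt' v m ->
    spine (E k) (A1 `\` Ef k) (J `\` Jf k) S lt' v m.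
  apply: spine_mono; first by move=> x [A1x nx]; split=> // Ex; apply: nx; exists k.
  by move=> x [Jx nx]; split=> // Ex; apply: nx; exists k.
have fink k : k \in C -> infinite_set (Zf k).
  move=> kC fin; have [_ sEs _ Z0 ns] := f k.
  by apply: (ns kC); apply: segment_finite => //; apply: Z0.
have [k0 k0C] : exists k, k \in C.
  have [a0 A0a0] := large_nonempty YA0; have Ya0 := AY (A0A A0a0).
  have [a1 Ya1 aa] := cwo_no_max Yinf Ycwo Ya0.
  have [_ _ hab] := hgA; have [v [Jv vP]] := large_nonempty (hab a1 Ya1).
  by have [k kC _] := vP a0 (A0A A0a0) aa; exists k.
have Zinf : infinite_set Zu.
  move=> fin; apply: (fink k0 k0C); apply: sub_finite_set fin => x Zx.
  by exists k0.
have [k [S [lt' [v [m [q [kC sp la ZS]]]]]]] := segment_some Zinf sZ sE sJ.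
have [_ _ _ _ ns] := f k; apply: (ns kC).
have ZkS : Zf k #<= S.
  by apply: card_le_trans ZS; apply: subset_card_le => x Zx; exists k.
have [S' [q' [sp' la' h1 h2]]] := spine_truncate (fink k kC) (mono _ _ _ _ _ sp) la ZkS.
by exists S', lt', v, m, q'.
Qed.

(** [h d] lies beyond the point that unavoidability gives for the part of [A0] from [d] on, and also
    so far up that its segment bounds the exceptional set. The second property yields a common bound
    for all earlier chain points. *)
Lemma next_point k : k \in C -> exists h : T -> T, forall d, Y d ->
  [/\ Y (h d), lt d (h d) &
    [set v | above C A (h d) v /\ forall z, A0 z -> d = z \/ lt d z ->
       lt z (h d) -> ~ E k z v] #<= seg lt Y (h d)].
Proof.
move=> kC.
suff /choice[h hP] : forall d, exists d', Y d -> [/\ Y d', lt d d' &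
    [set v | above C A d' v /\ forall z, A0 z -> d = z \/ lt d z ->
       lt z d' -> ~ E k z v] #<= seg lt Y d'] by exists h.
move=> d; have [Yd|] := pselect (Y d); last by exists d.
pose A' := A0 `\` seg lt Y d.
have YA' : Y #<= A' by apply: large_setD => //; apply: small_seg.
have [|y [Yy sy]] := unA kC _ YA'; first by move=> z [/A0A].
have [x Yx hx] := card_le_seg Ywo sy.
have [d1 Yd1 dd1] := cwo_no_max Yinf Ycwo Yd.
have [c1 [Yc1 xc yc]] := wo_max2 Ywo Yx Yy.
have [c [Yc c1c d1c]] := wo_max2 Ywo Yc1 Yd1.
have le_trans a b : Y a -> Y b -> a = b \/ lt a b -> b = c \/ lt b c -> a = c \/ lt a c.
  move=> Ya Yb [-> //|ab] bc; right; exact: (wo_lt_le Ywo Ya Yb Yc).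
have xc' := le_trans _ _ Yx Yc1 xc c1c.
have yc' := le_trans _ _ Yy Yc1 yc c1c.
exists c; split=> //.
  exact: (wo_lt_le Ywo Yd Yd1 Yc).
apply: card_le_trans (card_le_trans _ hx) _.
  apply: subset_card_le => v [av nE]; split; first exact: above_anti av.
  move=> z [A0z nz] zy; have Yz := AY (A0A A0z); apply: nE => //.
    by apply: (wo_nlt Ywo) => // zd; apply: nz.
  by apply: (wo_lt_le Ywo Yz Yy Yc).
by apply: subset_card_le; apply: seg_subset.
Qed.

Definition block (h : T -> T) (t : T) : set T :=
  [set z | [/\ A0 z, t = z \/ lt t z & lt z (h t)]].

Definition piece_ok (k : 'I_r) (h : T -> T) (X : set T) (t : T)
    (p : piece T V) : Prop :=
  [/\ J (pc_u p), block h t (pc_x p), E k (pc_x p) (pc_u p),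
      forall s, X s -> s = t \/ lt s t -> exists2 z, block h s z & E k z (pc_u p)
    & [/\ spine (E k) A1 J (pc_S p) (pc_lt p) (pc_v p) (pc_m p),
        last_of (pc_lt p) (pc_S p) (pc_q p), block h t #<= pc_S p,
        pc_S p #<= block h t &
        forall b, is_lim (pc_lt p) (pc_S p) b -> pc_v p b <> pc_u p]].

(** The premises on [p'] restore what the recursion does not pass on: a step receives a bare set of
    earlier pieces, without knowing that they are small and have finite blocks. *)
Definition piece_new (t : T) (P : set (piece T V)) (p : piece T V) : Prop :=
  forall p', P p' -> pc_S p' #<= seg lt Y t ->
    (forall a, pc_S p' a -> finite_set (pc_m p' a)) ->
    [/\ forall a b y, pc_S p' a -> pc_S p b -> pc_m p' a y -> pc_m p b y -> False,
      pc_u p <> pc_u p', forall a, pc_S p' a -> pc_u p <> pc_v p' a,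
      forall b, is_lim (pc_lt p) (pc_S p) b -> pc_v p b <> pc_u p'
    & forall a b, pc_S p' a -> is_lim (pc_lt p) (pc_S p) b -> pc_v p b <> pc_v p' a].

Lemma piece_exists k h X t P : k \in C ->
  (forall Z Es Ej, Z !=set0 ->
    small Y Z -> small Y Es -> small Y Ej -> segment_for k Z Es Ej) ->
  (forall d, Y d -> [/\ Y (h d), lt d (h d) &
    [set v | above C A (h d) v /\ forall z, A0 z -> d = z \/ lt d z ->
       lt z (h d) -> ~ E k z v] #<= seg lt Y (h d)]) ->
  X `<=` Y -> (forall s t, X s -> X t -> lt s t -> h s = t \/ lt (h s) t) ->
  X t -> P #<= seg lt Y t ->
  exists p, piece_ok k h X t p /\ piece_new t P p.
Proof.
move=> kC seg_k hP XY X1 Xt PY; have Yt := XY t Xt; have [ir tr mn] := Ywo.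
have [Yht tht _] := hP t Yt.
have sPY : small Y P by apply: small_le PY _; apply: small_seg.
pose Q := [set p | [/\ P p, pc_S p #<= seg lt Y t &
    forall a, pc_S p a -> finite_set (pc_m p a)]].
have sQ : small Y Q by apply: small_sub sPY => p [].
pose I := \bigcup_(p in Q) (pair p @` pc_S p).
have sI : small Y I.
  apply: (small_bigcup Yinf sQ (small_seg Yt)) => p [_ h1 _].
  by apply: card_le_trans h1; apply: card_image_le.
pose Es := \bigcup_(i in I) pc_m i.1 i.2.
have sEs : small Y Es.
  by apply: small_bigcup_finite => // _ [p [_ _ fin] [a Sa <-]]; apply: fin.
pose Ej := (\bigcup_(p in Q) (pc_v p @` pc_S p)) `|` @pc_u T V @` Q.
have sEj : small Y Ej.
  apply: small_setU => //; last exact: small_image.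
  apply: (small_bigcup Yinf sQ (small_seg Yt)) => p [_ h1 _].
  by apply: card_le_trans h1; apply: card_image_le.
have hle s : X s -> s = t \/ lt s t -> h s = h t \/ lt (h s) (h t).
  move=> Xs [->|st]; first by left.
  have [Yhs _ _] := hP s (XY s Xs).
  by right; apply: (wo_le_lt Ywo Yhs Yt Yht (X1 s t Xs Xt st)).
pose Exc s := [set v | above C A (h s) v /\ forall z, A0 z -> s = z \/ lt s z ->
       lt z (h s) -> ~ E k z v].
pose It := [set s | X s /\ (s = t \/ lt s t)].
(* For [s] up to [t] the exceptional set is bounded by the segment below [h s], hence by the one
   below [h t]. *)
have sExc : small Y (\bigcup_(s in It) Exc s).
  have sh := small_seg Yht.
  apply: (small_bigcup Yinf _ sh).
    apply: small_sub sh => s [Xs st]; split; first exact: XY.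
    by apply: (wo_le_lt Ywo _ Yt) => //; apply: XY.
  move=> s [Xs st]; have [Yhs _ h1] := hP s (XY s Xs).
  apply: card_le_trans h1 _; apply: subset_card_le.
  by apply: seg_subset => //; apply: hle.
have [_ _ hab] := hgA.
have [u [[au nu] nEj]] := large_nonempty
  (large_setD Yinf (large_setD Yinf (hab _ Yht) sExc) sEj).
have uZ s : X s -> s = t \/ lt s t -> exists2 z, block h s z & E k z u.
  move=> Xs st; apply: contrapT => n; apply: nu; exists s; first by split.
  have [Yhs _ _] := hP s (XY s Xs).
  split; first by apply: above_anti au => //; apply: hle.
  by move=> z A0z sz zh Ez; apply: n; exists z.
have [x Zx Exu] := uZ t Xt (or_introl erefl).
have sZ : small Y (block h t).
  apply: small_sub (small_seg Yht) => z [A0z _ zh]; split=> //.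
  exact/AY/A0A.
have [||||S [lt' [v [m [q [sp la ZS SZ]]]]]] := seg_k (block h t) Es (Ej `|` [set u]).
- by exists x.
- by [].
- by [].
- by apply: small_setU => //; apply: small_finite.
exists (Piece x u S lt' v m q); split.
- split=> //=; first by case: au.
  split=> //.
  + by apply: spine_mono sp => y [].
  + by move=> b /(spine_limJ sp)[_ n] e; apply: n; right.
- move=> p' Pp' h1 fin /=; have Qp' : Q p' by [].
  split.
  + move=> a b y Sa Sb ma /(spine_blk sp Sb)[_ n]; apply: n.
    by exists (p', a) => //; exists p' => //; exists a.
  + by move=> e; apply: nEj; right; exists p'.
  + by move=> a Sa e; apply: nEj; left; exists p' => //; exists a.
  + by move=> b /(spine_limJ sp)[_ n] e; apply: n; left; right; exists p'.
  + move=> a b Sa /(spine_limJ sp)[_ n] e; apply: n; left; left.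
    by exists p' => //; exists a.
Qed.

Lemma pieces_exist : exists k h X (f : T -> piece T V),
  [/\ k \in C, X `<=` Y & forall t, X t -> Y (h t)] /\
  [/\
    forall x, Y x -> exists t, [/\ X t, t = x \/ lt t x & lt x (h t)],
    forall s t, X s -> X t -> lt s t -> h s = t \/ lt (h s) t,
    forall t, X t -> piece_ok k h X t (f t) &
    forall t, X t -> piece_new t (f @` [set s | X s /\ lt s t]) (f t)].
Proof.
have [k kC seg_k] := segment_colour.
have [h hP] := next_point kC.
have [|X [XY X1 X2]] := closed_chain (h := h) Ywo.
  by move=> x /hP[].
have [y0 Yy0] := large_nonempty YA0.
have [t0 [Xt0 _ _]] := X2 y0 (AY (A0A Yy0)).
have [p0 _] := piece_exists kC seg_k hP XY X1 Xt0 (card_ge0 _ _).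
have [|f fP] := @greedy _ _ p0 lt Y (fun t P p => X t ->
  piece_ok k h X t p /\ piece_new t P p) Ywo.
  move=> t P Yt PY; have [Xt|] := pselect (X t); last by exists p0.
  have [p hp] := piece_exists kC seg_k hP XY X1 Xt PY.
  by exists p.
exists k, h, X, f; split.
  by split=> // t /XY/hP[].
split=> //.
  by move=> t Xt; have [] := fP t (XY t Xt) Xt.
move=> t Xt _ [s [Xs st] <-]; have [_] := fP t (XY t Xt) Xt; apply.
by exists s => //; split=> //; apply: XY.
Qed.

(** Positions are ordered by their chain point and then inside the piece. The first position of
    piece [t] gets the limit vertex [u t]; any other limit is already a limit of its piece. The
    interval vertices must be put into blocks, because [u t] has its neighbours among them. *)
Lemma glue_pieces : has_spine E C Y J.
Proof.
have [k [h [X [f [[kC XY hY] [X2 X1 fok fnew]]]]]] := pieces_exist.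
have [ir tr mn] := Ywo.
pose Q t := pc_S (f t); pose R t := pc_lt (f t); pose x t := pc_x (f t).
pose u t := pc_u (f t); pose v t := pc_v (f t); pose m t := pc_m (f t).
pose l t := pc_q (f t); pose Z := block h.
have sp t : X t -> spine (E k) A1 J (Q t) (R t) (v t) (m t).
  by move=> /fok[_ _ _ _ []].
have wR t (Xt : X t) := spine_wo (sp t Xt).
have la t : X t -> last_of (R t) (Q t) (l t) by move=> /fok[_ _ _ _ []].
have Zx t : X t -> Z t (x t) by move=> /fok[].
have xu t : X t -> E k (x t) (u t) by move=> /fok[].
have Ju t : X t -> J (u t) by move=> /fok[].
have uZ t s : X t -> X s -> s = t \/ lt s t -> exists2 z, Z s z & E k z (u t).
  by move=> /fok[_ _ _ hu _]; apply: hu.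
have vu t b : X t -> is_lim (R t) (Q t) b -> v t b <> u t.
  by move=> /fok[_ _ _ _ [_ _ _ _]]; apply.
have ZQ t : X t -> Z t #<= Q t by move=> /fok[_ _ _ _ []].
have lt_total s t : X s -> X t -> s <> t -> lt s t \/ lt t s.
  by move=> /XY Ys /XY Yt ne; case: (wo_total Ywo Ys Yt); auto.
have ZA0 t z : Z t z -> A0 z by case.
have AY0 z : A0 z -> Y z by move=> /A0A/AY.
have fresh s t : X s -> X t -> lt s t ->
    [/\ forall a b y, Q s a -> Q t b -> m s a y -> m t b y -> False,
      u t <> u s, forall a, Q s a -> u t <> v s a,
      forall b, is_lim (R t) (Q t) b -> v t b <> u s
    & forall a b, Q s a -> is_lim (R t) (Q t) b -> v t b <> v s a].
  move=> Xs Xt st; apply: (fnew t Xt); first by exists s.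
    have [_ _ _ _ [_ _ _ h1 _]] := fok s Xs.
    (* The interval of [s] ends at [h s], which is at most [t], so piece [s] is no larger than the
       segment below [t]. *)
    apply: card_le_trans h1 _; apply: subset_card_le => z [A0z _ zh].
    have Yz := AY0 _ A0z; split=> //.
    exact: (wo_lt_le Ywo Yz (hY s Xs) (XY t Xt) zh (X1 s t Xs Xt st)).
  by move=> a Qa; apply: (spine_fin (sp s Xs)).
have Zdisj s t z : X s -> X t -> Z s z -> Z t z -> s = t.
  suff aux s' t' z' : X s' -> X t' -> Z s' z' -> Z t' z' -> ~ lt s' t'.
    move=> Xs Xt Zs Zt; apply: contrapT => /(lt_total _ _ Xs Xt)[].
      exact: (aux _ _ _ Xs Xt Zs Zt).
    exact: (aux _ _ _ Xt Xs Zt Zs).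
  move=> Xs Xt [A0z _ zh] [_ tz _] st.
  have Yz := AY0 _ A0z.
  have zt := wo_lt_le Ywo Yz (hY _ Xs) (XY _ Xt) zh (X1 _ _ Xs Xt st).
  by case: tz => [e|tz]; [apply: (ir z') => //; rewrite -{2}e|
    apply: (wo_asym Ywo Yz (XY _ Xt) zt)].
have Qdisj s t a y b : X s -> X t -> Q s a -> Q t b -> m s a y -> m t b y ->
    s = t.
  move=> Xs Xt Qa Qb ma mb; apply: contrapT => /(lt_total _ _ Xs Xt)[st|ts].
    by have [n _ _ _ _] := fresh s t Xs Xt st; apply: (n a b y).
  by have [n _ _ _ _] := fresh t s Xt Xs ts; apply: (n b a y).
pose S := [set a | exists2 t, X t & Q t a].
have /choice[ow owP] : forall a, exists t, S a -> X t /\ Q t a.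
  by move=> a; have [[t Xt Qa]|n] := pselect (S a); [exists t|exists a].
have Xow a : S a -> X (ow a) by move=> /owP[].
have Qow a : S a -> Q (ow a) a by move=> /owP[].
have owE t a : X t -> Q t a -> ow a = t.
  move=> Xt Qa; have Sa : S a by exists t.
  apply: (Qdisj _ _ a a a) => //; [exact: Xow|exact: Qow| |].
    by apply: (spine_self (sp _ (Xow _ Sa))); apply: Qow.
  exact: (spine_self (sp _ Xt)).
have QS t a : X t -> Q t a -> S a by move=> ? ?; exists t.
have /choice[fi fiP] : forall t, exists a, X t -> Q t a /\
    forall s, Q t s -> s = a \/ R t a s.
  move=> t; have [Xt|] := pselect (X t); last by exists t.
  have [_ _ h1] := wR t Xt; have [||a ha] := h1 (Q t); first by [].
    by exists (l t); case: (la t Xt).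
  by exists a.
have Qfi t : X t -> Q t (fi t) by move=> /fiP[].
have nRfi t a : X t -> Q t a -> ~ R t a (fi t).
  move=> Xt Qa Ra; have [_ h1] := fiP t Xt; have [e|Rf] := h1 a Qa.
    by have [irR _ _] := wR t Xt; apply: (irR a Qa); rewrite {2}e.
  exact: (wo_asym (wR t Xt) Qa (Qfi t Xt)).
have /choice[g gP] : forall t, exists g : T -> T, X t ->
    (forall z, Z t z -> Q t (g z)) /\
    (forall z z', Z t z -> Z t z' -> g z = g z' -> z = z').
  move=> t; have [Xt|] := pselect (X t); last by exists id.
  by have [g hg] := card_leE (l t) (ZQ t Xt); exists g.
pose L a b := lt (ow a) (ow b) \/ (ow a = ow b /\ R (ow a) a b).
pose vf a := if pselect (a = fi (ow a)) is left _ then u (ow a) else v (ow a) a.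
pose own a := [set z | [/\ Z (ow a) z, z <> x (ow a) & g (ow a) z = a]].
(* A new block is the block of the piece with at most one interval vertex added through [g]. The
   vertex [x t] is exempt from [g]: it must sit at the first position, as the neighbour of [u t]
   there. *)
pose mf a := m (ow a) a `|` own a `|`
  [set z | a = fi (ow a) /\ z = x (ow a)].
have wL : wo L S.
  split.
  - move=> a Sa [|[_]]; first by apply: ir; apply: XY; apply: Xow.
    by have [irR _ _] := wR _ (Xow _ Sa); apply: irR; apply: Qow.
  - move=> a b c Sa Sb Sc; have [Ya Yb Yc] := And3 (XY _ (Xow _ Sa)) (XY _ (Xow _ Sb)) (XY _ (Xow _ Sc)).
    case=> [ab|[eab ab]] [bc|[ebc bc]].
    + by left; apply: tr bc.
    + by left; rewrite -ebc.
    + by left; rewrite eab.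
    + right; split; first by rewrite eab.
      have [_ trR _] := wR _ (Xow _ Sa).
      have Qa := Qow _ Sa; have := Qow _ Sb; have := Qow _ Sc.
      rewrite -ebc -eab => Qc Qb; apply: trR ab _ => //.
      by rewrite eab.
  - move=> B BS [b0 Bb0].
    have [||_ [[b1 Bb1 <-] h1]] := mn (ow @` B).
    + by move=> _ [b /BS/Xow/XY Yb <-].
    + by exists (ow b0); exists b0.
    have X1' := Xow _ (BS _ Bb1).
    have [_ _ mnR] := wR _ X1'.
    have [||b [[Bb eb] h2]] := mnR (B `&` [set b | ow b = ow b1]).
    + by move=> b [/BS/Qow Qb e]; rewrite -e.
    + by exists b1.
    exists b; split=> // s Bs; have [|e|ls] := h1 (ow s); first by exists s.
      by have [->|Rbs] := h2 s (conj Bs e); [left|right; right; rewrite eb e].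
    by right; left; rewrite eb.
have limR a : is_lim L S a -> a <> fi (ow a) -> is_lim (R (ow a)) (Q (ow a)) a.
  move=> [Sa _ h1] na; have Xa := Xow _ Sa; have Qa := Qow _ Sa.
  have [_ hfi] := fiP _ Xa; split=> //.
    by exists (fi (ow a)); [exact: Qfi|case: (hfi a Qa)].
  move=> b Qb ba; have eb := owE _ _ Xa Qb.
  have [|c [Sc bc ca]] := h1 b (QS _ _ Xa Qb); first by right; rewrite eb.
  have ec : ow c = ow a.
    case: bc => [bc|[<- _]]; last by rewrite eb.
    case: ca => [ca|[]//]; move: bc; rewrite eb => bc.
    by case: (wo_asym Ywo (XY _ Xa) (XY _ (Xow _ Sc)) bc).
  exists c; split; first by rewrite -ec; apply: Qow.
    case: bc => [bc|[_]]; last by rewrite eb.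
    by move: bc; rewrite eb ec => bc; case: (ir _ (XY _ Xa) bc).
  case: ca => [ca|[_]]; last by rewrite ec.
  by move: ca; rewrite ec => ca; case: (ir _ (XY _ Xa) ca).
have vff a : a = fi (ow a) -> vf a = u (ow a) by rewrite /vf; case: pselect.
have vfn a : a <> fi (ow a) -> vf a = v (ow a) a by rewrite /vf; case: pselect.
have place t z : X t -> Z t z -> exists2 a, Q t a & mf a z.
  move=> Xt Zz; have [->|nz] := pselect (z = x t).
    by exists (fi t); [exact: Qfi|right; rewrite (owE t) //; exact: Qfi].
  have [gQ _] := gP t Xt; exists (g t z); first exact: gQ.
  by left; right; split; rewrite (owE t) //; exact: gQ.
exists k, S, L, vf, mf; split=> //.
- split=> //.
  + move=> a Sa y [[my|[Zy _ _]]|[_ ->]].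
    * by apply/AY/A1A; apply: (spine_blk (sp _ (Xow _ Sa)) (Qow _ Sa)).
    * exact/AY0/ZA0/Zy.
    * by apply/AY0/(ZA0 (ow a))/Zx/Xow.
  + move=> a Sa; rewrite !finite_setU; split; [split|].
    * exact: (spine_fin (sp _ (Xow _ Sa)) (Qow _ Sa)).
    * apply: finite_subsingleton => y z [Zy _ ey] [Zz _ ez].
      by have [_ ginj] := gP _ (Xow _ Sa); apply: ginj; rewrite // ey.
    * by apply: finite_subsingleton => y z [_ ->] [_ ->].
  + move=> a Sa; left; left.
    exact: (spine_self (sp _ (Xow _ Sa)) (Qow _ Sa)).
  + move=> a b y Sa Sb.
    have [Xa Xb Qa Qb] := And4 (Xow _ Sa) (Xow _ Sb) (Qow _ Sa) (Qow _ Sb).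
    have mA1 c : S c -> m (ow c) c y -> A1 y.
      by move=> Sc; apply: (spine_blk (sp _ (Xow _ Sc)) (Qow _ Sc)).
    have ownA0 c : S c -> own c y \/ (c = fi (ow c) /\ y = x (ow c)) ->
       Z (ow c) y.
      by move=> Sc [[]//|[_ ->]]; apply: Zx; apply: Xow.
    have sep c d : S c -> S d -> m (ow c) c y ->
       own d y \/ (d = fi (ow d) /\ y = x (ow d)) -> False.
      move=> Sc Sd mc od; apply: (A01 (ZA0 _ _ (ownA0 d Sd od))).
      exact: mA1 mc.
    have mfE c : mf c y -> m (ow c) c y \/
       (own c y \/ (c = fi (ow c) /\ y = x (ow c))).
      by case=> [[|]|]; auto.
    move=> /mfE[ma|oa] /mfE[mb|ob].
    * have e := Qdisj _ _ _ _ _ Xa Xb Qa Qb ma mb.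
      by apply: (spine_disj (sp _ Xa)) ma _ => //; rewrite e.
    * by case: (sep a b).
    * by case: (sep b a).
    * have e := Zdisj _ _ _ Xa Xb (ownA0 _ Sa oa) (ownA0 _ Sb ob).
      case: oa ob => [[_ nx ga]|[fa ya]] [[_ nx' gb]|[fb yb]].
      - by rewrite -ga -gb e.
      - by case: nx; rewrite e.
      - by case: nx'; rewrite -e.
      - by rewrite fa fb e.
  + move=> a la0; have [Sa _ _] := la0; have Xa := Xow _ Sa.
    have [e|ne] := pselect (a = fi (ow a)).
      by rewrite vff //; apply: Ju.
    by rewrite vfn //; apply: (spine_limJ (sp _ Xa)); apply: limR.
  + move=> a la0; have [Sa _ _] := la0; have Xa := Xow _ Sa.
    have [e|ne] := pselect (a = fi (ow a)).
      exists (x (ow a)); first by right.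
      by rewrite vff //; apply: xu.
    rewrite vfn //; have [y my Ey] := spine_limE (sp _ Xa) (limR a la0 ne).
    by exists y => //; left; left.
  + move=> a b la0 Sb ba; have [Sa _ hlim] := la0; have Xa := Xow _ Sa.
    have Xb := Xow _ Sb.
    have [e|ne] := pselect (a = fi (ow a)).
      have lba : lt (ow b) (ow a).
        case: ba => [//|[eb Rb]]; case: (nRfi (ow a) b Xa).
          by rewrite -eb; apply: Qow.
        by rewrite -e -eb.
      (* The limit [a] is preceded by an element [c] beyond the last position of the piece of [b].
         So [c] lies in a piece strictly between, whose interval contains a neighbour of the limit
         vertex. *)
      have [Ql hl] := la _ Xb; have owl := owE _ _ Xb Ql.
      have [|c [Sc lc ca]] := hlim (l (ow b)) (QS _ _ Xb Ql).
        by left; rewrite owl.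
      have Xc := Xow _ Sc.
      have lbc : lt (ow b) (ow c).
        case: lc; rewrite owl // => -[ec Rlc].
        have Qc : Q (ow b) c by rewrite ec; apply: Qow.
        have [eq|Rcl] := hl c Qc.
          by have [irR _ _] := wR _ Xb; case: (irR c Qc); rewrite {1}eq.
        by case: (wo_asym (wR _ Xb) Qc Ql Rcl).
      have lca : lt (ow c) (ow a).
        case: ca => [//|[ec Rc]]; case: (nRfi (ow a) c Xa).
          by rewrite -ec; apply: Qow.
        by rewrite -e -ec.
      have [z Zz Ez] := uZ (ow a) (ow c) Xa Xc (or_intror lca).
      have [d Qd md] := place _ _ Xc Zz; have ed := owE _ _ Xc Qd.
      exists d, z; split=> //.
      - exact: QS Qd.
      - by right; left; rewrite ed.
      - by left; rewrite ed.
      - by rewrite vff.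
    rewrite vfn //; have lR := limR a la0 ne.
    have [Qa _ _] := lR.
    (* If [b] is in an earlier piece, move up to the first position of the piece of [a]. *)
    have [b' [Qb' ba' bb']] : exists b', [/\ Q (ow a) b', R (ow a) b' a & b = b' \/ L b b'].
      case: ba => [ba|[eb Rb]].
        have Qf := Qfi _ Xa; exists (fi (ow a)); split=> //.
          by have [_ hfi] := fiP _ Xa; case: (hfi a Qa).
        by right; left; rewrite (owE _ _ Xa Qf).
      exists b; split; [by rewrite -eb; apply: Qow|by rewrite -eb|by left].
    have [c [y [Qc b'c ca my Ey]]] := spine_limC (sp _ Xa) lR Qb' ba'.
    have ec := owE _ _ Xa Qc; have eb' := owE _ _ Xa Qb'.
    have Sc := QS _ _ Xa Qc.
    exists c, y; split=> //.
    * have b'c' : b' = c \/ L b' c.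
        by case: b'c => [->|Rb]; [left|right; right; rewrite eb' ec].
      case: bb' => [-> //|Lb]; right.
      exact: (wo_lt_le wL Sb (QS _ _ Xa Qb') Sc Lb b'c').
    * by right; rewrite ec.
    * by left; left; rewrite ec.
  + move=> a b la0 lb0; have [Sa _ _] := la0; have [Sb _ _] := lb0.
    have Xa := Xow _ Sa; have Xb := Xow _ Sb.
    have aux s t c d : X s -> X t -> lt s t -> S c -> S d -> ow c = s -> ow d = t ->
      is_lim L S d -> vf c = vf d -> False.
      move=> Xs Xt st Sc Sd ec ed ld.
      have [_ n1 n2 n3 n4] := fresh s t Xs Xt st.
      have Qc : Q s c by rewrite -ec; apply: Qow.
      have [fd|nd] := pselect (d = fi (ow d)).
        rewrite (vff d) // ed => e.
        have [fc|nc] := pselect (c = fi (ow c)).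
          by apply: n1; rewrite -e vff // ec.
        by apply: (n2 c Qc); rewrite -e vfn // ec.
      have := limR d ld nd; rewrite (vfn d) // ed => ld' e.
      have [fc|nc] := pselect (c = fi (ow c)).
        by apply: (n3 d ld'); rewrite -e vff // ec.
      by apply: (n4 c d Qc ld'); rewrite -e vfn // ec.
    have [e|ne] := pselect (ow a = ow b); last first.
      move=> ve; case: (lt_total _ _ Xa Xb ne) => l0.
        by case: (aux _ _ a b Xa Xb l0).
      by case: (aux _ _ b a Xb Xa l0).
    have [fa|na] := pselect (a = fi (ow a)); have [fb|nb] := pselect (b = fi (ow b)).
    * by move=> _; rewrite fa fb e.
    * rewrite vff // vfn // => ve.
      by case: (vu (ow b) b Xb (limR b lb0 nb)); rewrite -ve e.
    * rewrite (vff b) // vfn // => ve.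
      by case: (vu (ow a) a Xa (limR a la0 na)); rewrite ve e.
    * rewrite !vfn // => ve; apply: (spine_inj (sp _ Xa)).
      - exact: limR.
      - by rewrite e; apply: limR.
      - by rewrite ve e.
- apply: card_le_trans YA0 _.
  (* Each element of [A0] lies in an interval of the chain, and [g] sends it to a position, so there
     are at least as many positions as elements of [A0]. *)
  have /choice[po poP] : forall z, exists t, A0 z -> X t /\ Z t z.
    move=> z; have [A0z|] := pselect (A0 z); last by exists z.
    by have [t [Xt tz zh]] := X2 z (AY0 z A0z); exists t.
  apply: (@card_leI _ _ _ _ (fun z => g (po z) z)) => [z /poP[Xt Zz]|z z' A0z A0z'].
    by exists (po z) => //; have [gQ _] := gP _ Xt; apply: gQ.
  have [Xt Zz] := poP z A0z; have [Xt' Zz'] := poP z' A0z' => e.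
  have [gQ ginj] := gP _ Xt; have [gQ' _] := gP _ Xt'.
  have et : po z = po z'.
    by rewrite -(owE _ _ Xt (gQ _ Zz)) -(owE _ _ Xt' (gQ' _ Zz')) e.
  apply: ginj => //; first by rewrite et.
  by rewrite e et.
Qed.

End Minimal.
End HalfGraph.

(** * Star-linked sets *)

Lemma half_graph_spine (T V : Type) (r : nat) (E : 'I_r -> T -> V -> Prop)
    (lt : T -> T -> Prop) (Y : set T) (J : set V) (C : {set 'I_r}) :
  infinite_set Y -> cwo lt Y ->
  (forall Y', infinite_set Y' -> small Y Y' -> spinable E Y') ->
  half_graph E lt Y J C Y -> has_spine E C Y J.
Proof.
move=> Yinf Ycwo Yind /(half_graph_minimal)[C0 [A [C0C hgA unA]]].
have [AY YA _] := hgA.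
have [A0 [A0A [YA0 YA1]]] := bisect1 Yinf YA.
have A1A : A `\` A0 `<=` A by move=> x [].
have A01 x : A0 x -> (A `\` A0) x -> False by move=> ? [].
have [k [S [L [v [m [kC sp YS]]]]]] :=
  glue_pieces Yinf Ycwo Yind hgA unA A0A YA0 A1A YA1 A01.
exists k, S, L, v, m; split=> //.
by move/fintype.subsetP: C0C; apply.
Qed.

Lemma spinable_step (T V : Type) (r : nat) (E : 'I_r -> T -> V -> Prop)
    (Y : set T) : infinite_set Y ->
  (forall Y', infinite_set Y' -> small Y Y' -> spinable E Y') -> spinable E Y.
Proof.
move=> Yinf Yind J C YJ cm; have [lt Ycwo] := cwo_exists Y.
apply: (half_graph_spine Yinf Ycwo Yind); split=> // y Yy; apply: card_le_trans YJ _; apply: subset_card_le => v Jv.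
by split=> // z Yz _; apply: cm.
Qed.

(** Induction on cardinality, run over the points of a well-order of the whole type: a set smaller
    than one that embeds below [x] embeds below some earlier [y]. *)
Lemma spinable_all (T V : Type) (r : nat) (E : 'I_r -> T -> V -> Prop)
    (Y : set T) : infinite_set Y -> spinable E Y.
Proof.
have [lt [w cw]] := cwo_exists [set: T].
have segs x : forall Y', infinite_set Y' -> Y' #<= seg lt setT x -> spinable E Y'.
  apply: (@wo_ind _ lt setT (fun x => forall Y', infinite_set Y' ->
    Y' #<= seg lt setT x -> spinable E Y') w) => // {}x _ IH Y' inf Y'x.
  apply: spinable_step => // Y2 inf2 sY2.
  have [|y [_ yx] hy] := @card_le_seg _ _ lt (seg lt setT x) Y2 (wo_sub w (@seg_sub _ _ _ _)).
    by move=> h; apply: sY2; apply: card_le_trans Y'x h.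
  apply: (IH y) => //; apply: card_le_trans hy _; apply: subset_card_le.
  by move=> z [[]].
move=> inf; apply: spinable_step => // Y' inf' sY'.
have [|x _ hx] := @card_le_seg _ _ lt setT Y' w.
  by move=> h; apply: sY'; apply: card_le_trans h; apply: subset_card_le.
exact: segs hx.
Qed.

Section Stars.
Variables (T V : Type) (r : nat) (E : 'I_r -> T -> V -> Prop).
Variables (lt : T -> T -> Prop) (Y I : set T) (J : set V).
Hypotheses (Yinf : infinite_set Y) (Ycwo : cwo lt Y).
Hypotheses (YI : Y #<= I) (YJ : Y #<= J).
Hypothesis IJ : forall x, I x -> small Y [set v | J v /\ forall k, ~ E k x v].

Definition star (k : 'I_r) (X : set T) : Prop := forall F, F `<=` X ->
  finite_set F -> Y #<= [set v | J v /\ forall x, F x -> E k x v].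

Definition missed (D : {set 'I_r}) (F : set T) : set V :=
  [set v | J v /\ forall x d, F x -> d \in D -> ~ E d x v].

Lemma star_sub k X X' : X' `<=` X -> star k X -> star k X'.
Proof. by move=> XX h F FX; apply: h => x /FX/XX. Qed.

(** The sets [missed D F], modulo small sets, generate a proper filter. In an ultrafilter above it
    each [x] in [X] has the neighbourhood of one colour outside [D]; by pigeonhole one colour serves
    a large set, and finite intersections of its neighbourhoods stay in the ultrafilter, hence are
    large. *)
Lemma new_star (D : {set 'I_r}) X : X `<=` I -> Y #<= X ->
  (forall F, F `<=` X -> finite_set F -> Y #<= missed D F) ->
  exists k X', [/\ k \notin D, X' `<=` X, Y #<= X' & star k X'].
Proof.
move=> XI YX hm.
pose Fl : set_system V := [set B | exists F N,
  [/\ F `<=` X, finite_set F, small Y N & missed D F `\` N `<=` B]].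
have FlF : ProperFilter Fl.
  split.
    move=> [F [N [FX fF sN sub]]].
    have h := large_setD Yinf (hm F FX fF) sN.
    apply: Yinf; apply: card_le_finite h _.
    by apply: sub_finite_set sub _.
  split.
  - exists set0, set0; split=> //; first exact: small_finite.
  - move=> P Q [F [N [FX fF sN sub]]] [F' [N' [FX' fF' sN' sub']]].
    exists (F `|` F'), (N `|` N'); split.
    + by move=> x [/FX|/FX'].
    + by rewrite finite_setU.
    + exact: small_setU.
    + move=> v [[Jv h] nN]; split.
        apply: sub; split; last by move=> Nv; apply: nN; left.
        by split=> // x d Fx; apply: h; left.
      apply: sub'; split; last by move=> Nv; apply: nN; right.
      by split=> // x d Fx; apply: h; right.
  - move=> P Q PQ [F [N [FX fF sN sub]]]; exists F, N; split=> //.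
    exact: subset_trans PQ.
have [G [GU FG]] := ultraFilterLemma FlF.
have GP : ProperFilter G by apply: ultra_proper.
have GI (A B : set V) : G A -> G B -> G (A `&` B) by move=> GA GB; exact: filterI.
have Gsmall N : small Y N -> G (~` N).
  by move=> sN; apply: FG; exists set0, N; split=> // v [].
have GJ : G J by apply: FG; exists set0, set0; split=> //;
  [exact: small_finite|move=> v [[]]].
have /choice[col colP] : forall x, exists k, X x -> k \notin D /\ G [set v | E k x v].
  move=> x; have [Xx|nX] := pselect (X x); last first.
    (* Off [X] any colour will do; one exists, since otherwise [IJ] would fail at an element of
       [X]. *)
    have [[k _]|n] := pselect (exists k : 'I_r, True); first by exists k.
    have [x1 Xx1] : X !=set0 by apply: large_nonempty YX.
    have [v [Jv hv]] : [set v | J v /\ forall k, ~ E k x1 v] !=set0.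
      apply: (large_nonempty Yinf); apply: card_le_trans YJ _.
      apply: subset_card_le => v Jv; split=> // k; exfalso; apply: n; by exists k.
    case: (IJ (XI _ Xx1)); apply: card_le_trans YJ _; apply: subset_card_le => w Jw.
    by split=> // k; case: n; exists k.
  apply: contrapT => n.
  (* If no colour outside [D] had its neighbourhood in [G], a common point of sets in [G] would have
     no edge to [x] at all while avoiding the small set of [IJ]. *)
  have h k : G [set v | k \notin D -> ~ E k x v].
    have [kD|kD] := boolP (k \in D).
      by apply: filterS filterT => v _ /negP[].
    have [GE|GE] := in_ultra_setVsetC [set v | E k x v] GU.
      by case: n; exists k.
    by apply: filterS GE => v /= nE _.
  have hall : G [set v | forall k, k \notin D -> ~ E k x v] by apply: filter_forall.
  have hD : G (missed D [set x]).
    apply: FG; exists [set x], set0; split.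
    + by move=> y ->.
    + exact: finite_set1.
    + exact: small_finite.
    + by move=> w [].
  have hI := GI _ _ (GI _ _ hall hD) (Gsmall _ (IJ (XI _ Xx))).
  have [v [[h1 [Jv h2]] h3]] := @filter_ex _ _ GP _ hI; apply: h3; split=> // k.
  by have [kD|kD] := boolP (k \in D); [apply: h2|apply: h1].
have [k kL] : exists k, Y #<= X `&` [set x | col x = k].
  apply: contrapT => n.
  have := @small_bigcup_fin _ _ Yinf _ _ (fun k => X `&` [set x | col x = k]).
  case; first by move=> k hk; apply: n; exists k.
  by apply: card_le_trans YX _; apply: subset_card_le => x Xx; exists (col x).
exists k, (X `&` [set x | col x = k]); split=> //.
- have [x [Xx <-]] := large_nonempty Yinf kL.
  by have [] := colP x Xx.
- move=> F FX fF.
  have GF : G [set v | forall x, F x -> E k x v].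
    have {}FX x : F x -> G [set v | E k x v].
      by move=> /FX[Xx <-]; have [] := colP x Xx.
    have [s es] := (@finite_seqP {classic T} F).1 fF.
    move: FX; rewrite es => {es fF}; elim: s => [|x s IH] h.
      by apply: filterS filterT => v _ x /=; rewrite in_nil.
    have := GI _ _ (h x (mem_head _ _)) (IH (fun y ys => h y (mem_behead (s := x :: s) ys))).
    apply: filterS => v [h1 h2] y /=; rewrite inE => /orP[/eqP -> //|]; exact: h2.
  apply: contrapT => /Gsmall Gn.
  by have [v [[h1 h2] n]] := @filter_ex _ _ GP _ (GI _ _ (GI _ _ GJ GF) Gn); apply: n.
Qed.

(** Induction on the number of colours outside [D]: where the block property fails, [new_star]
    supplies a further colour. *)
Lemma maximal_stars : exists (D : {set 'I_r}) X, [/\ X `<=` I, Y #<= X,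
  forall d, d \in D -> star d X &
  forall X', X' `<=` X -> Y #<= X' ->
    exists F, [/\ F `<=` X', finite_set F & small Y (missed D F)]].
Proof.
suff main n (D : {set 'I_r}) X : (#|~: D| <= n)%N -> X `<=` I -> Y #<= X ->
    (forall d, d \in D -> star d X) -> exists (D : {set 'I_r}) X,
    [/\ X `<=` I, Y #<= X, forall d, d \in D -> star d X &
    forall X', X' `<=` X -> Y #<= X' ->
    exists F, [/\ F `<=` X', finite_set F & small Y (missed D F)]].
  apply: (main _ finset.set0 I (leqnn _)) => // d.
  by rewrite finset.in_set0.
elim: n D X => [|n IH] D X Dn XI YX sD.
all: have [h|] := pselect (forall X', X' `<=` X -> Y #<= X' ->
    exists F, [/\ F `<=` X', finite_set F & small Y (missed D F)]).
1,3: by exists D, X.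
all: move=> /existsNP[X' /not_implyP[X'X /not_implyP[YX' nF]]].
all: have X'I : X' `<=` I by apply: subset_trans XI.
all: have [|k [X2 [kD X2X' YX2 sk]]] := @new_star D X' X'I YX'.
1,3: by move=> F FX' fF; apply: contrapT => sm; apply: nF; exists F.
  by move: Dn; rewrite leqn0 cards_eq0 => /eqP/finset.setP/(_ k);
    rewrite finset.in_setC finset.in_set0 kD.
apply: (IH (k |: D) X2) => //.
- rewrite -ltnS; apply: leq_trans Dn; apply: proper_card.
  rewrite properC; apply/properP; split; first exact: subsetU1.
  by exists k => //; rewrite setU11.
- exact: subset_trans X'I.
- move=> d; rewrite in_setU1 => /orP[/eqP -> //|dD].
  by apply: star_sub (sD d dD); apply: subset_trans X'X.
Qed.

(** Cardinalities below that of [Y] are compared through the least segment that bounds them. *)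
Lemma minimal_card U (P : set U) (M : U -> set V) : P !=set0 ->
  (forall p, P p -> small Y (M p)) ->
  exists p, P p /\ forall p', P p' -> M p #<= M p'.
Proof.
move=> [p0 Pp0] sM; have [w _] := Ycwo.
have [x0 Yx0 h0] := card_le_seg w (sM p0 Pp0).
have [||x [[Yx [p Pp hp]] xmin]] := @wo_min _ _ _
  [set x | Y x /\ exists2 p, P p & M p #<= seg lt Y x] w.
- by move=> x [].
- by exists x0; split=> //; exists p0.
exists p; split=> // p' Pp'; apply: contrapT => n.
have [|y [Yy yx] hy] := @card_le_seg _ _ lt (seg lt Y x) (M p') (wo_sub w (@seg_sub _ _ _ _)).
  by move=> h; apply: n; apply: card_le_trans hp h.
apply: (xmin y) => //; split=> //; exists p' => //.
by apply: card_le_trans hy _; apply: subset_card_le => z [[]].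
Qed.

Definition block_rel (f : T -> set T) (k : 'I_r) (y : T) (v : V) : Prop :=
  exists2 x, f y x & E k x v.

(* Choosing the blocks with exceptional sets as small as possible makes these
   sets increase, so they are bounded along initial segments even when |Y| is
   singular. *)
Lemma blocks_exist (D : {set 'I_r}) X : Y #<= X ->
  (forall X', X' `<=` X -> Y #<= X' ->
    exists F, [/\ F `<=` X', finite_set F & small Y (missed D F)]) ->
  exists f : T -> set T, [/\
    forall y, Y y -> [/\ f y `<=` X, finite_set (f y) & f y !=set0],
    forall y z x, Y y -> Y z -> f y x -> f z x -> y = z &
    half_graph (block_rel f) lt Y J D Y].
Proof.
move=> YX hX; have [w sm] := Ycwo.
pose hit F := [/\ F `<=` X, finite_set F & small Y (missed D F)].
pose apart (S : set (set T)) F := forall F', S F' -> hit F' -> forall x, F x -> F' x -> False.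
pose P (y : T) S F := [/\ hit F, apart S F &
  forall F', hit F' -> apart S F' -> missed D F #<= missed D F'].
have [|f fP] := @greedy T (set T) set0 lt Y P w.
  move=> y S Yy Sy.
  have sU : small Y (\bigcup_(F in S `&` hit) F).
    apply: small_bigcup_finite => //; last by move=> F [_ []].
    apply: small_le (sm y Yy); apply: card_le_trans Sy.
    by apply: subset_card_le => F [].
  have [|F0 [F0X F0f F0s]] := hX _ _ (large_setD Yinf YX sU); first by move=> x [].
  have [||F [[hF aF] Fmin]] := @minimal_card (set T) [set F | hit F /\ apart S F] (missed D).
  - exists F0; split; first by split=> // x /F0X[].
    by move=> F' SF' hF' x /F0X[_ n] F'x; apply: n; exists F'.
  - by move=> F [[]].
  by exists F; split=> // F' h1 h2; apply: Fmin.
have fh y : Y y -> hit (f y) by move=> /fP[].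
have disj y z x : Y y -> Y z -> lt y z -> f y x -> f z x -> False.
  move=> Yy Yz yz fy fz; have [_ a _] := fP z Yz.
  by apply: (a (f y) _ (fh y Yy) x) => //; exists y.
exists f; split.
- move=> y Yy; have [h1 h2 h3] := fh y Yy; split=> //.
  apply: contrapT => n; apply: h3; apply: card_le_trans YJ _.
  by apply: subset_card_le => v Jv; split=> // x d fx; case: n; exists x.
- move=> y z x Yy Yz fy fz; have [//|yz|zy] := wo_total w Yy Yz.
    by case: (disj y z x).
  by case: (disj z y x).
- split=> // y Yy.
  have sB : small Y (\bigcup_(z in seg lt Y y) missed D (f z)).
    have [_ _ sfy] := fh y Yy.
    apply: (small_bigcup Yinf (sm y Yy) sfy) => z [Yz zy].
    (* The later block [f y] was still a candidate at stage [z], so its exceptional set bounds that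
       of [f z]. *)
    have [_ _ zmin] := fP z Yz; apply: zmin; first exact: fh.
    move=> _ [z' [Yz' z'z] <-] _ x fyx fz'x; apply: (disj z' y x) => //.
    by have [_ tr _] := w; apply: tr z'z zy.
  apply: card_le_trans (large_setD Yinf YJ sB) _; apply: subset_card_le.
  move=> v [Jv n]; split=> // z Yz zy; apply: contrapT => nd; apply: n.
  exists z; first by split.
  by split=> // x d fx dD Ed; apply: nd; exists d => //; exists x.
Qed.

(* The vertices of [J1] are reserved for the connections between consecutive
   elements, the others for the limit vertices. *)
Lemma linked_spine : I `<=` Y -> exists k X (f : T -> set T) S L v m J1,
  [/\ X `<=` I, star k X,
    forall y, Y y -> [/\ f y `<=` X, finite_set (f y) & f y !=set0] &
    forall y z x, Y y -> Y z -> f y x -> f z x -> y = z] /\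
  [/\ spine (block_rel f k) Y (J `\` J1) S L v m, Y #<= S &
    forall x x', X x -> X x' -> Y #<= [set w | [/\ J w, J1 w, E k x w & E k x' w]]].
Proof.
move=> IY; have [D [X [XI YX sD hX]]] := maximal_stars.
have [f [fX fdisj [_ _ hab]]] := blocks_exist YX hX.
(* The sets to be halved by [J1]: in each colour the common neighbourhoods of pairs, and under
   [None] the sets [above], which must stay large outside [J1] to leave a half graph. Only the large
   members are passed to [bisect]. *)
pose fam (q : option 'I_r * (T * T)) : set V :=
  if q.1 is Some d then [set w | [/\ J w, E d q.2.1 w & E d q.2.2 w]]
  else above (block_rel f) lt J D Y q.2.1.
pose dom := [set: option 'I_r] `*` (Y `*` Y).
have domY : dom #<= Y.
  apply: card_le_trans (card_sq Yinf); apply: card_leX; last exact: card_sq.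
  apply: card_leNge => /card_le_finite h; apply: Yinf; apply: h.
  exact: finite_finset.
have [||J1 J1P] := @bisect _ _ Yinf _ _ [set B | (fam @` dom) B /\ Y #<= B] id.
- apply: card_le_trans domY; apply: card_le_trans (card_image_le fam dom).
  by apply: subset_card_le => B [].
- by move=> B [].
pose J0 := J `\` J1.
have hg0 : half_graph (block_rel f) lt Y J0 D Y.
  split=> // y Yy; have [|_ h] := J1P (above (block_rel f) lt J D Y y).
    by split; [exists (None, (y, y))|exact: hab].
  by apply: card_le_trans h _; apply: subset_card_le => v [[Jv h] nJ1].
have [|k [S [L [v [m [kD sp YS]]]]]] := half_graph_spine Yinf Ycwo _ hg0.
  by move=> Y' inf _; apply: spinable_all.
exists k, X, f, S, L, v, m, J1; split; first by split=> //; apply: sD.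
split=> // x x' Xx Xx'.
have [|h _] := J1P [set w | [/\ J w, E k x w & E k x' w]].
  split.
    by exists (Some k, (x, x')) => //; split=> //; split; apply/IY/XI.
  have := sD k kD [set x; x']; move=> h.
  apply: card_le_trans (h _ _) _; first by move=> z [] ->.
    exact: finite_set2.
  by apply: subset_card_le => w [Jw hw]; split=> //; apply: hw; [left|right].
by apply: card_le_trans h _; apply: subset_card_le => w [[]].
Qed.

End Stars.

(** * From spines to generalised paths *)

Lemma adjC (U : Type) (H : graph U) x y : adj H x y -> adj H y x.
Proof. by rewrite /adj setUC. Qed.

Lemma adj_verts (U : Type) (H : graph U) x y : adj H x y -> verts H x /\ verts H y.
Proof.
move=> /(@edgesP _ H)[x' [y' [vx vy _ e]]].
have : [set x'; y'] x by rewrite -e; left.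
have : [set x'; y'] y by rewrite -e; right.
by move=> [] -> [] ->.
Qed.

Section Induced.
Variables (U : Type) (H : graph U) (W : set U).

(** The conditions on a path only demand edges and forbid none, so all edges of [H] inside the
    vertex set may be kept. *)
Definition induced_edges : set (set U) :=
  [set e | edges H e /\ exists x y, [/\ W x, W y & e = [set x; y]]].

Lemma induced_edgesP e : induced_edges e ->
  exists x y, [/\ W x, W y, x <> y & e = [set x; y]].
Proof.
case=> /(@edgesP _ H)[x [y [_ _ nxy ->]]] [x' [y' [Wx Wy e']]].
have hW z : [set x; y] z -> W z by rewrite e' => -[] ->.
by exists x, y; split=> //; apply: hW; [left|right].
Qed.

Definition induced : graph U := Graph induced_edgesP.

Lemma adj_induced x y : W x -> W y -> adj H x y -> adj induced x y.
Proof. by move=> Wx Wy h; split=> //; exists x, y. Qed.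

End Induced.

Section Path.
Variables (U K : Type) (H : graph U) (a b : K -> U) (lt : K -> K -> Prop).
Variables (X J J1 S : set K) (f m : K -> set K) (L : K -> K -> Prop) (v : K -> K).
Hypotheses (a_inj : injective a) (b_inj : injective b).
Hypothesis ab : forall x w, X x -> J w -> a x <> b w.
Hypotheses (Kinf : infinite_set [set: K]) (Kcwo : cwo lt [set: K]).
Hypothesis fX : forall y, [/\ f y `<=` X, finite_set (f y) & f y !=set0].
Hypothesis fdisj : forall y z x, f y x -> f z x -> y = z.
Hypothesis sp : spine (fun y w => exists2 x, f y x & adj H (a x) (b w))
  [set: K] (J `\` J1) S L v m.
Hypothesis conn : forall x x', X x -> X x' -> [set: K] #<=
  [set w | [/\ J w, J1 w, adj H (a x) (b w) & adj H (a x') (b w)]].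

Definition covered (s : K) : set K := \bigcup_(y in m s) f y.
Definition all_covered : set K := [set x | exists2 s, S s & covered s x].

Let Kwo : wo lt [set: K] := Kcwo.1.
Let wL : wo L S := spine_wo sp.

Lemma covered_finite s : S s -> finite_set (covered s).
Proof.
by move=> Ss; apply: bigcup_finite; [exact: (spine_fin sp)|move=> y _; case: (fX y)].
Qed.

Lemma covered_X s : covered s `<=` X.
Proof. by move=> x [y _]; have [h _ _] := fX y; apply: h. Qed.

Lemma covered_nonempty s : S s -> covered s !=set0.
Proof.
move=> Ss; have [_ _ [x fx]] := fX s; exists x; exists s => //.
exact: (spine_self sp).
Qed.

Lemma covered_disj s t x : S s -> S t -> covered s x -> covered t x -> s = t.
Proof.
move=> Ss St [y my fy] [z mz fz]; have e := fdisj fy fz.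
by apply: (spine_disj sp Ss St my); rewrite e.
Qed.

Lemma all_covered_X : all_covered `<=` X.
Proof. by move=> x [s _ /covered_X]. Qed.

Lemma all_covered_card : S #<= all_covered.
Proof.
have /choice[g gP] : forall s, exists x, S s -> covered s x.
  move=> s; have [Ss|] := pselect (S s); last by exists s.
  by have [x hx] := covered_nonempty Ss; exists x.
apply: (@card_leI _ _ _ _ g) => [s Ss|s t Ss St e]; first by exists s => //; apply: gP.
by apply: (covered_disj Ss St (gP s Ss)); rewrite e; apply: gP.
Qed.

(** Elements are ordered by position, then inside their finite block. At a limit position the
    neighbour of the limit vertex given by [spine_limE] is moved to the front of the block, since it
    comes right after that vertex on the path. *)
Lemma order_exists : exists (pos : K -> K) (L2 : K -> K -> Prop), [/\
  forall x, all_covered x -> S (pos x) /\ covered (pos x) x,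
  wo L2 all_covered,
  forall x y, all_covered x -> all_covered y -> L (pos x) (pos y) -> L2 x y,
  forall x y, all_covered x -> all_covered y -> L2 x y ->
     pos x = pos y \/ L (pos x) (pos y) &
  forall x, all_covered x -> is_lim L S (pos x) ->
    (forall y, all_covered y -> L2 y x -> pos y <> pos x) ->
    adj H (a x) (b (v (pos x)))].
Proof.
have /choice[pos posP] : forall x, exists s, all_covered x -> S s /\ covered s x.
  move=> x; have [[s Ss cx]|] := pselect (all_covered x); first by exists s.
  by exists x.
have posE s x : S s -> covered s x -> pos x = s.
  move=> Ss cx; have [Sp cp] := posP x (ex_intro2 _ _ s Ss cx).
  exact: covered_disj cp cx.
have /choice[en enP] : forall s, exists x, S s -> covered s x /\
    (is_lim L S s -> adj H (a x) (b (v s))).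
  move=> s; have [Ss|] := pselect (S s); last by exists s.
  have [ls|nl] := pselect (is_lim L S s).
    have [y my [x fx ax]] := spine_limE sp ls.
    by exists x => _; split=> //; exists y.
  by have [x cx] := covered_nonempty Ss; exists x.
have enS s : S s -> covered s (en s) by move=> /enP[].
pose loc s x y := x <> y /\ (x = en s \/ (y <> en s /\ lt x y)).
pose L2 x y := L (pos x) (pos y) \/ (pos x = pos y /\ loc (pos x) x y).
have [irK trK mnK] := Kwo; have [irL trL mnL] := wL.
have loc_tr s x y z : loc s x y -> loc s y z -> loc s x z.
  move=> [nxy [xe|[nye xy]]] [nyz [ye|[nze yz]]].
  - by case: nxy; rewrite xe ye.
  - by split; [move=> e; apply: nze; rewrite -e|left].
  - by case: nye.
  - have xz : lt x z by apply: trK yz.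
    by split; [move=> e; apply: (irK z) => //; rewrite -{1}e|right].
exists pos, L2; split=> //.
- split.
  + by move=> x /posP[Sx _] [|[_ []//]]; apply: irL.
  + move=> x y z /posP[Sx _] /posP[Sy _] /posP[Sz _].
    case=> [xy|[exy xy]] [yz|[eyz yz]].
    * by left; apply: trL yz.
    * by left; rewrite -eyz.
    * by left; rewrite exy.
    * right; split; first by rewrite exy.
      by apply: loc_tr xy _; rewrite exy.
  + move=> B BS [x0 Bx0].
    have [||_ [[x1 Bx1 <-] h1]] := mnL (pos @` B).
    * by move=> _ [x /BS/posP[Sx _] <-].
    * by exists (pos x0); exists x0.
    have [Ss _] := posP _ (BS _ Bx1); set s := pos x1 in h1 Ss.
    have [Be|nBe] := pselect (B (en s)).
      exists (en s); split=> // y By.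
      have ep : pos (en s) = s by apply: posE => //; apply: enS.
      have [|e|l] := h1 (pos y); first by exists y.
        have [->|ne] := pselect (y = en s); first by left.
        by right; right; rewrite ep e; split=> //; split; [exact: nesym|left].
      by right; left; rewrite ep.
    have [||x [[Bx ex] h2]] := mnK (B `&` [set x | pos x = s]).
    * by [].
    * by exists x1.
    exists x; split=> // y By.
    have [|e|l] := h1 (pos y); first by exists y.
      have [->|xy] := h2 y (conj By e); first by left.
      right; right; rewrite ex e; split=> //; split.
        by move=> exy; apply: (irK x) => //; rewrite {2}exy.
      by right; split=> // ye; apply: nBe; rewrite -ye.
    by right; left; rewrite ex.
- by move=> x y _ _; left.
- by move=> x y _ _ [|[]]; [right|left].
- move=> x cx lx hx; have [Sx px] := posP x cx.
  have [ce ae] := enP _ Sx.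
  have [->|ne] := pselect (x = en (pos x)).
    by rewrite (posE (pos x) (en (pos x))) //; apply: ae.
  have ep := posE _ _ Sx ce.
  case: (hx (en (pos x))) => //; first by exists (pos x).
  by right; rewrite ep; split=> //; split; [exact: nesym|left].
Qed.

(** Every [a x] is followed by a connector to the next element and, if [x] is a limit, preceded by a
    limit vertex. Limit vertices have covered neighbours cofinally below them; all others have an
    adjacent immediate predecessor unless they come first. *)
Lemma concentrated_path_exists : exists (P : graph U) (leP : rel U),
  [/\ generalised_path P leP, verts P #<= [set: K], subgraph P H,
      a @` all_covered `<=` verts P & concentrated H P leP (a @` all_covered)].
Proof.
have [pos [L2 [posP wL2 LL2 L2L enP]]] := order_exists.
set XS := all_covered in posP wL2 LL2 L2L enP *.
have [ir2 tr2 mn2] := wL2; have [irL trL mnL] := wL.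
have XSX := all_covered_X.
have XS_intro s x : S s -> covered s x -> XS x by move=> Ss cx; exists s.
have posE s x : S s -> covered s x -> pos x = s.
  move=> Ss cx; have [Sp cp] := posP x (XS_intro _ _ Ss cx).
  exact: covered_disj cp cx.
(* Blocks are finite and convex in the order, so an element with a block mate below it has an
   immediate predecessor. *)
have lim_first x y : is_lim L2 XS x -> XS y -> L2 y x -> pos y <> pos x.
  move=> [cx _ hl] cy yx ep; have [Sx px] := posP x cx.
  have [|||q [[cq qx] qlast]] := @finite_last _ L2 (covered (pos x) `&` [set z | L2 z x]).
  - by apply: wo_sub wL2 _ => z [cz _]; apply: XS_intro cz.
  - exact: finite_setIl (covered_finite Sx).
  - by exists y; split=> //; rewrite -ep; case: (posP y cy).
  have Xq := XS_intro _ _ Sx cq.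
  have [w [cw qw wx]] := hl q Xq qx.
  have pw : pos w = pos x.
    have [//|l1] := L2L _ _ cw cx wx.
    have [e|l2] := L2L _ _ Xq cw qw.
      by rewrite -e (posE _ _ Sx cq).
    move: l2; rewrite (posE _ _ Sx cq) => l2.
    by case: (wo_asym wL Sx (posP w cw).1 l2).
  have [|e|wq] := qlast w; first by split=> //; rewrite -pw; case: (posP w cw).
    by case: (ir2 q Xq); rewrite -{2}e.
  exact: (wo_asym wL2 Xq cw qw).
have lim_pos x : is_lim L2 XS x -> is_lim L S (pos x).
  move=> lx; have [cx [u cu ux] hl] := lx; have [Sx px] := posP x cx.
  have below y : XS y -> L2 y x -> L (pos y) (pos x).
    by move=> cy yx; have [e|//] := L2L _ _ cy cx yx; case: (lim_first x y lx).
  split=> //; first by exists (pos u); [case: (posP u cu)|exact: below].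
  move=> t St tx.
  have [|||q [cq qlast]] := @finite_last _ L2 (covered t).
  - by apply: wo_sub wL2 _ => z cz; apply: XS_intro cz.
  - exact: covered_finite.
  - exact: covered_nonempty.
  have Xq := XS_intro _ _ St cq; have eq := posE _ _ St cq.
  have [|w [cw qw wx]] := hl q Xq; first by apply: LL2 => //; rewrite eq.
  exists (pos w); split; [by case: (posP w cw)| |exact: below].
  have [e|] := L2L _ _ Xq cw qw; last by rewrite eq.
  have cw' : covered t w by rewrite -eq e; case: (posP w cw).
  have [e'|wq] := qlast w cw'; first by case: (ir2 q Xq); rewrite -{2}e'.
  by case: (wo_asym wL2 Xq cw qw).
have lim_adj x : is_lim L2 XS x -> adj H (a x) (b (v (pos x))).
  move=> lx; apply: enP; [by case: lx|exact: lim_pos|].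
  by move=> y cy; apply: lim_first.
pose succ x y := [/\ XS y, L2 x y & forall z, XS z -> L2 x z -> y = z \/ L2 y z].
(* A last element is its own [nx], so that [conn] provides a connector in every case. *)
have /choice[nx nxP] : forall x, exists y, (XS x -> XS y) /\
    forall y', XS x -> succ x y' -> y' = y.
  move=> x; have [[y [cy xy hy]]|n] := pselect (exists y, succ x y); last first.
    by exists x; split=> // y' _ sy; case: n; exists y'.
  exists y; split=> // y' _ [cy' xy' hy'].
  have [//|l1] := hy' y cy xy; have [//|l2] := hy y' cy' xy'.
  by case: (wo_asym wL2 cy cy' l2).
have [k0 _] : [set: K] !=set0 by apply: infinite_setN0.
have [|c [cP cinj]] := @greedy_inj K K k0 lt XS
  (fun x => [set w | [/\ J w, J1 w, adj H (a x) (b w) & adj H (a (nx x)) (b w)]])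
  (wo_sub Kwo (fun _ _ => I)).
  move=> x cx hle; case: Kcwo => _ /(_ x I); apply.
  have [/(_ cx) cnx _] := nxP x.
  apply: card_le_trans (conn (XSX _ cx) (XSX _ cnx)) (card_le_trans hle _).
  by apply: subset_card_le => z [].
pose lim2 := is_lim L2 XS.
(* Tag 0 is the limit vertex before [x], tag 1 is [a x], and tag 2 is the connector after it. *)
pose PI := [set p : K * nat | [/\ XS p.1, (p.2 < 3)%N & p.2 = 0%N -> lim2 p.1]].
pose vx (p : K * nat) : U :=
  match p.2 with 0 => b (v (pos p.1)) | 1 => a p.1 | _ => b (c p.1) end.
(* Limit vertices avoid [J1] while connectors lie in it, so the two kinds never coincide. *)
have vJ x : lim2 x -> J (v (pos x)) /\ ~ J1 (v (pos x)).
  by move=> /lim_pos/(spine_limJ sp).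
have vx_inj p q : PI p -> PI q -> vx p = vx q -> p = q.
  case: p q => [x [|[|[|i]]]] [y [|[|[|j]]]] [/= cx xi hx] [/= cy yj hy] //;
    rewrite /vx /=.
  - move=> /b_inj e; have lx := hx erefl; have ly := hy erefl.
    have ep := spine_inj sp (lim_pos _ lx) (lim_pos _ ly) e.
    have [-> //|xy|yx] := wo_total wL2 cx cy.
      by case: (lim_first y x ly).
    by case: (lim_first x y lx).
  - by move=> e; case: (ab (XSX _ cy) (vJ x (hx erefl)).1).
  - move=> /b_inj e; have [_] := vJ x (hx erefl); rewrite e => n.
    by have [_ /n] := cP y cy.
  - by move=> e; case: (ab (XSX _ cx) (vJ y (hy erefl)).1).
  - by move=> /a_inj ->.
  - by move=> e; have [Jc _ _ _] := cP y cy; case: (ab (XSX _ cx) Jc).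
  - move=> /b_inj e; have [_] := vJ y (hy erefl); rewrite -e => n.
    by have [_ /n] := cP x cx.
  - by move=> e; have [Jc _ _ _] := cP x cx; case: (ab (XSX _ cy) Jc).
  - by move=> /b_inj/(cinj _ _ cx cy) ->.
pose LP (p q : K * nat) := L2 p.1 q.1 \/ (p.1 = q.1 /\ (p.2 < q.2)%N).
have wLP : wo LP PI.
  split.
  - by move=> p [cp _ _] [|[_]]; [apply: ir2|rewrite ltnn].
  - move=> p q s [cp _ _] [cq _ _] [cs _ _].
    case=> [pq|[epq pq]] [qs|[eqs qs]].
    + by left; apply: tr2 qs.
    + by left; rewrite -eqs.
    + by left; rewrite epq.
    + by right; rewrite epq; split=> //; apply: ltn_trans qs.
  - move=> B BS [p0 Bp0].
    have [||_ [[p1 Bp1 <-] h1]] := mn2 (fst @` B).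
    + by move=> _ [p /BS[cp _ _] <-].
    + by exists p0.1; exists p0.
    have [n Bn nmin] : exists2 n, B (p1.1, n) & forall n', B (p1.1, n') -> (n <= n')%N.
      have ex : exists n, `[< B (p1.1, n) >].
        by exists p1.2; apply/asboolP; case: p1 Bp1 {h1}.
      case: (ex_minnP ex) => n /asboolP Bn hn; exists n => // n' Bn'.
      by apply: hn; apply/asboolP.
    exists (p1.1, n); split=> // -[x n'] Bs.
    have [|/= e|l] := h1 x; first by exists (x, n').
      subst x; have := nmin n' Bs; rewrite leq_eqVlt => /orP[/eqP ->|l].
        by left.
      by right; right.
    by right; left.
pose VP := vx @` PI.
have /choice[key keyP] : forall u, exists p, VP u -> PI p /\ vx p = u.
  move=> u; have [[p Pp <-]|] := pselect (VP u); first by exists p.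
  by exists (k0, 0%N).
have keyE p : PI p -> key (vx p) = p.
  move=> Pp; have [Pk ek] : PI (key (vx p)) /\ vx (key (vx p)) = vx p.
    by apply: keyP; exists p.
  exact: vx_inj.
pose leP : rel U := fun u w => `[< u = w \/ LP (key u) (key w) >].
have strictE u w : VP u -> VP w -> (strict leP u w <-> LP (key u) (key w)).
  move=> Vu Vw; have [Pu _] := keyP u Vu; have [irP _ _] := wLP.
  split; first by case=> /asboolP[].
  by move=> l; split; [apply/asboolP; right|move=> e; apply: (irP _ Pu); rewrite {2}e].
pose P := induced H VP.
(* Used twice: for the path property at tags 1 and 2, and to see that such vertices are not limit
   elements of the path. *)
have prev p q : PI p -> p.2 <> 0%N -> PI q -> LP q p ->
    exists r, [/\ PI r, adj H (vx p) (vx r), LP r p &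
      forall w, PI w -> LP w p -> w = r \/ LP w r].
  case: p => [x [|[|[|i]]]] [/= cx xi hx] // _ Pq qp; last first.
    exists (x, 1%N); split=> //.
    - by apply: adjC; have [_ _] := cP x cx.
    - by right.
    - case=> y n [/= cy _ hy] [/= l|[/= -> n2]]; first by right; left.
      by case: n n2 {hy} => [|[|//]] _; [right; right|left].
  have [lx|nl] := pselect (lim2 x).
    exists (x, 0%N); split=> //.
    - exact: lim_adj.
    - by right.
    - case=> y n [/= cy _ hy] [/= l|[/= -> n1]]; first by right; left.
      by case: n n1 {hy} => // _; left.
  have qx : L2 q.1 x.
    case: qp => // -[/= e q0]; have [_ _ hq] := Pq; case: nl; rewrite -e.
    by apply: hq; case: (q.2) q0.
  have [p0 [cp px hp]] : exists p0, [/\ XS p0, L2 p0 x &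
      forall w, XS w -> L2 p0 w -> ~ L2 w x].
    apply: contrapT => n; apply: nl; split=> //.
      by exists q.1 => //; case: Pq.
    move=> u cu ux; apply: contrapT => n'; apply: n; exists u; split=> //.
    by move=> w cw uw wx; apply: n'; exists w.
  have enx : x = nx p0.
    have [_] := nxP p0; apply => //; split=> // z cz pz.
    by apply: (wo_nlt wL2) => // zx; apply: (hp z).
  exists (p0, 2%N); split=> //=.
  - by have [_ _ _] := cP p0 cp; rewrite -enx.
  - by left.
  - case=> y n [/= cy n3 hy] yx.
    have {}yx : L2 y x.
      case: yx => // -[/= e n1]; case: nl; rewrite -e; apply: hy.
      by case: n n1 {n3}.
    have [e|py|yp] := wo_total wL2 cp cy.
    + rewrite -e; move: n3; rewrite ltnS leq_eqVlt => /orP[/eqP ->|n2]; first by left.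
      by right; right.
    + by case: (hp y).
    + by right; left.
have prev0 p q : PI p -> p.2 = 0%N -> PI q -> LP q p ->
    exists r, [/\ PI r, r.2 = 1%N, adj H (vx p) (vx r), LP q r & LP r p].
  case: p => [x n] [/= cx _ hx] n0; subst n => Pq qp.
  have lx := hx erefl; have [Sx px] := posP x cx.
  have cq : XS q.1 by case: Pq.
  have qx : L2 q.1 x by case: qp => // -[].
  have lt_pos y : XS y -> L2 y x -> L (pos y) (pos x).
    by move=> cy yx; have [e|//] := L2L _ _ cy cx yx; case: (lim_first x y lx).
  have lS := lim_pos x lx; have [_ _ hl] := lS.
  (* The intermediate position [t] places the neighbour [z] strictly beyond the position of [q]. *)
  have [t [St qt tx]] := hl _ (posP _ cq).1 (lt_pos _ cq qx).
  have [w [y [Sw tw ws my [z fz az]]]] := spine_limC sp lS St tx.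
  have cwz : covered w z by exists y.
  have cz := XS_intro _ _ Sw cwz; have ez := posE _ _ Sw cwz.
  exists (z, 1%N); split=> //.
  - exact: adjC az.
  - left; apply: LL2 => //; rewrite ez.
    exact: (wo_lt_le wL (posP _ cq).1 St Sw qt tw).
  - by left; apply: LL2 => //; rewrite ez.
have vxV p : PI p -> VP (vx p) by exists p.
have leP_key u w : VP u -> VP w -> key u = key w \/ LP (key u) (key w) -> leP u w.
  move=> Vu Vw [e|l]; apply/asboolP; [left|by right].
  by rewrite -(keyP u Vu).2 -(keyP w Vw).2 e.
have VH : VP `<=` verts H.
  have adjx x : XS x -> verts H (a x) /\ verts H (b (c x)).
    by move=> cx; have [_ _ h _] := cP x cx; apply: adj_verts h.
  move=> _ [[x [|[|[|i]]]] [/= cx xi hx] <-] //; rewrite /vx /=.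
  - by have [] := adj_verts (lim_adj x (hx erefl)).
  - by have [] := adjx x cx.
  - by have [] := adjx x cx.
exists P, leP; split.
- split.
  + apply: antisymmetric_wo_chain.
      move=> u w Vu Vw /andP[/asboolP[//|uw] /asboolP[//|wu]].
      move: Vu Vw; rewrite !inE => Vu Vw.
      case: (wo_asym wLP (keyP u Vu).1 (keyP w Vw).1 uw wu).
    move=> B BV [u0 Bu0].
    have BVP u : u \in B -> VP u by move=> /BV; rewrite inE.
    have [_ _ mnP] := wLP.
    have [||_ [[u Bu <-] hu]] := mnP (key @` [set u | u \in B]).
    * by move=> _ [u /BVP Vu <-]; case: (keyP u Vu).
    * by exists (key u0); exists u0.
    exists u; split=> // w Bw; apply: leP_key; [exact: BVP|exact: BVP|].
    by have [|e|l] := hu (key w); [exists w|left|right].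
  + move=> u u' Vu Vu' /(strictE _ _ Vu' Vu) l.
    have [Pu eu] := keyP u Vu; have [Pu' _] := keyP u' Vu'.
    have [r [Pr ar ur rl]] : exists r, [/\ PI r, adj H u (vx r),
        key u' = r \/ LP (key u') r & LP r (key u)].
      have [e|ne] := pselect ((key u).2 = 0%N).
        have [r [Pr _ ar l1 l2]] := prev0 _ _ Pu e Pu' l.
        by exists r; split=> //; [rewrite -eu|right].
      have [r [Pr ar l1 h]] := prev _ _ Pu ne Pu' l.
      by exists r; split=> //; [rewrite -eu|exact: h].
    have Vr := vxV r Pr; exists (vx r); split=> //.
    * exact: adj_induced.
    * by apply: leP_key => //; rewrite keyE.
    * by apply/strictE => //; rewrite keyE.
- apply: card_le_trans (card_image_le vx PI) _.
  apply: card_le_trans (card_sq Kinf).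
  apply: card_le_trans (subset_card_le (_ : PI `<=` [set: K] `*` [set: nat])) _ => //.
  by apply: card_leX => //; apply/infiniteP.
- by split=> // e [].
- by move=> _ [x cx <-]; exists (x, 1%N).
- move=> u x [Vu _ hl] Vx /(strictE _ _ Vx Vu) l.
  have [Pu eu] := keyP u Vu; have [Px _] := keyP x Vx.
  have [e|ne] := pselect ((key u).2 = 0%N); last first.
    have [r [Pr _ l1 h]] := prev _ _ Pu ne Px l; have Vr := vxV r Pr.
    have [|w [Vw rw wu]] := hl (vx r) Vr; first by apply/strictE => //; rewrite keyE.
    move: rw wu => /(strictE _ _ Vr Vw); rewrite keyE // => rw /(strictE _ _ Vw Vu) wu.
    have [Pw _] := keyP w Vw; have [irP _ _] := wLP.
    have [e|wr] := h _ Pw wu; first by move: rw; rewrite e => /(irP _ Pr).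
    by case: (wo_asym wLP Pr Pw rw wr).
  have [r [Pr r1 ar l1 l2]] := prev0 _ _ Pu e Px l; have Vr := vxV r Pr.
  exists (vx r); split; first split.
  + by rewrite /nbhd /= -eu.
  + by have [cr _ _] := Pr; exists r.1 => //; rewrite /vx r1.
  + split=> //; first by apply: leP_key => //; rewrite keyE //; right.
    by apply/strictE => //; rewrite keyE.
Qed.

End Path.

(** The two classes may share vertices. A small overlap is removed from [I]; a large one is halved,
    one half giving [I] and the [b]-indices of the other half giving [J]. *)
Lemma separate_classes (K U : Type) (a b : K -> U) : infinite_set [set: K] ->
  injective a -> injective b -> exists I J : set K,
  [/\ [set: K] #<= I, [set: K] #<= J & forall x w, I x -> J w -> a x <> b w].
Proof.
move=> Kinf a_inj b_inj.
pose I0 := [set x | exists w, a x = b w].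
have [sI|nI] := pselect (small [set: K] I0).
  exists (~` I0), setT; split=> //.
    by apply: card_le_trans (large_setD Kinf (card_lexx _) sI) _;
       apply: subset_card_le => x [].
  by move=> x w n _ e; apply: n; exists w.
have {nI} KI : [set: K] #<= I0 by apply: contrapT.
have [Ia [IaI [KIa KIb]]] := bisect1 Kinf KI.
have /choice[g gP] : forall x, exists w, I0 x -> a x = b w.
  by move=> x; have [[w e]|] := pselect (I0 x); [exists w|exists x].
exists Ia, (g @` (I0 `\` Ia)); split=> //.
  apply: card_le_trans KIb _; apply: (@card_leI _ _ _ _ g) => [x hx|x y [Ix _] [Iy _] e].
    by exists x.
  by apply: a_inj; rewrite (gP x Ix) (gP y Iy) e.
move=> x _ Iax [y [Iy nIay] <-]; rewrite -(gP y Iy) => /a_inj e.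
by apply: nIay; rewrite -e.
Qed.

Lemma adj_coloured (U : Type) (G : graph U) (r : nat) (c : edges G -> 'I_r) x y :
  adj G x y -> exists k, adj (colour_graph c k) x y.
Proof.
move=> h; have h' : edges G [set x; y] := h.
pose e : edges G := SigSub (mem_set h').
by exists (c e), e.
Qed.

Theorem theorem3p1 (K : Type) (le : rel K) (hK : is_infinite_cardinal le)
    (U : Type) (G : graph U) (A : set U) (hG : type_H le G A)
    (r : nat) (c : edges G -> 'I_r) :
  exists (k : 'I_r) (X : set U),
    [/\ X `<=` A,
        X #= [set: K],
        star_linked K (colour_graph c k) X
      & exists (P : graph U) (leP : rel U),
          [/\ generalised_path P leP,
              verts P #= [set: K],
              subgraph P (colour_graph c k),
              X `<=` verts P
            & concentrated (colour_graph c k) P leP X]].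
Proof.
have [[wole smle] Kinf] := hK.
have wlt := wo_strict wole.
have Kcwo : cwo (strict le) [set: K].
  split=> // x _ h; apply: (smle x); apply: card_le_trans h _.
  by apply: subset_card_le => y [].
have [B [a [b [eV [afun ainj asurj] [bfun binj bsurj] eadj]]]] := hG.
have a_inj : injective a by move=> x y; apply: ainj; rewrite inE.
have b_inj : injective b by move=> x y; apply: binj; rewrite inE.
have [I [J [KI KJ ab]]] := separate_classes Kinf a_inj b_inj.
pose E k x w := adj (colour_graph c k) (a x) (b w).
(* Only vertices of [J] with index below [x] can fail to be joined to [a x]. *)
have IJ x : I x -> small [set: K] [set w | J w /\ forall k, ~ E k x w].
  move=> Ix; apply: small_sub (Kcwo.2 x Logic.I) => w [Jw n]; split=> //.
  apply: contrapT => nl.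
  have lxw : le x w.
    by have [->|[]//] := wo_nlt wlt Logic.I Logic.I nl; apply: well_order_refl.
  by have [k hk] := adj_coloured c (eadj x w lxw (ab x w Ix Jw)); apply: (n k).
have [k [X [f [S [L [v [m [J1 [[XI sX fX fdisj] [sp KS conn]]]]]]]]]] :=
  linked_spine Kinf Kcwo KI KJ IJ (fun _ _ => Logic.I).
have abX x w : X x -> J w -> a x <> b w by move=> /XI; apply: ab.
have {}fX y := fX y Logic.I.
have {}fdisj y z x := fdisj y z x Logic.I Logic.I.
have [P [leP [gP PK sub XP con]]] :=
  concentrated_path_exists a_inj b_inj abX Kinf Kcwo fX fdisj sp conn.
have XSX := all_covered_X fX (S := S) (m := m).
have KXS := card_le_trans KS (all_covered_card fX fdisj sp).
set XS := all_covered S f m in XP con XSX KXS.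
have KaXS : [set: K] #<= a @` XS.
  apply: card_le_trans KXS _; apply: (@card_leI _ _ _ _ a) => [x hx|x y _ _ /a_inj//].
  by exists x.
(* The covered part of the star-linked set is taken: it still has full size, and star-linkedness
   passes to subsets. *)
exists k, (a @` XS); split.
- by move=> _ [x _ <-]; apply: afun.
- apply/card_eqPle; split=> //; apply: card_le_trans (card_image_le _ _) _.
  exact: subset_card_le.
- move=> F FX fF; apply/card_eqPle; split.
    apply: card_le_trans (_ : _ #<= A `|` B) _.
      by rewrite -eV; apply: subset_card_le => u [].
    apply: card_le_trans (card_sq Kinf).
    apply: card_le_trans (_ : _ #<= [set: bool] `*` [set: K]) _; last first.
      apply: card_leX => //; apply: card_leNge => /card_le_finite h.
      by apply: Kinf; apply: h; exact: finite_finset.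
    pose g (p : bool * K) := if p.1 then a p.2 else b p.2.
    apply: card_le_trans (card_image_le g _); apply: subset_card_le => u [/asurj|/bsurj] [x _ <-].
      by exists (true, x).
    by exists (false, x).
  pose F0 := [set x | X x /\ F (a x)].
  have fF0 : finite_set F0.
    apply: card_le_finite fF; apply: (@card_leI _ _ _ _ a) => [x []//|x y _ _].
    exact: a_inj.
  apply: card_le_trans (sX F0 _ fF0) _; first by move=> x [].
  apply: (@card_leI _ _ _ _ b) => [w [Jw hw]|x y _ _ /b_inj//].
  split; first by rewrite /= eV; right; apply: bfun.
  move=> u Fu; have [x hx ex] := FX u Fu; rewrite -ex.
  by apply: hw; split; [exact: XSX|rewrite ex].
- exists P, leP; split=> //; apply/card_eqPle; split=> //.
  by apply: card_le_trans KaXS _; apply: subset_card_le.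
Qed.
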